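(* Let $T$ be a complete theory, $M$ a small model, and $\mu\in\mathfrak M_x(\mathcal U)$ a global Keisler measure that is both definable over and finitely satisfiable in $M$. Suppose $M^*$ is a good extension of $M$ such that every formula is uniformly NIP in $M^*$. Then $\mu$ is fim over $M$.
   Context: $\mathcal U$ is the monster model. Keisler measures are identified with complete regular Borel probability measures on type spaces; global means over $\mathcal U$. $\mu$ is definable over $M$ if for every formula $\phi(x,y)$ the value $\mu(\phi(x,b))$ depends only on $\mathrm{tp}(b/M)$ and the induced map $S_y(M)\to[0,1]$ is continuous; finitely satisfiable in $M$ if every formula of positive measure is realized in $M$. A good extension of $M$ is an elementary extension $M^*\succeq M$ in which every $n$-type over $M$ ($n\in\mathbb N$) is realized. A formula $\phi(x,y)$ is uniformly NIP in a model $N$ if there is $n\in\mathbb N$ such that there are no $a_1,\dots,a_n\in N$ with $N\models\exists y(\bigwedge_{i\in I}\phi(a_i,y)\wedge\bigwedge_{i\notin I}\neg\phi(a_i,y))$ for every $I\subseteq\{1,\dots,n\}$. For $a_1,\dots,a_n$ and a formula $\phi(x,b)$, $\mathrm{Av}(a_1,\dots,a_n;\phi(x,b))=|\{i:\models\phi(a_i,b)\}|/n$. $\mu^{(n)}$ denotes the Morley power $\mu_{x_n}\otimes\cdots\otimes\mu_{x_1}$, where for $\mu$ definable over $M$, $\mu_x\otimes\lambda_y(\phi(x,y;b))=\int f\,d\lambda|_N$ with $f(\mathrm{tp}(d/N))=\mu(\phi(x,d;b))$, $N\supseteq Mb$. A global $M$-invariant measure $\mu$ is fim over $M$ if for every formula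 $\phi(x,y)$ and every $\epsilon>0$ there are $n$ and an $L(M)$-formula $\theta_\epsilon(x_1,\dots,x_n)$ with $\mu^{(n)}(\theta_\epsilon)\ge1-\epsilon$ such that for all $b\in\mathcal U$ and all $(a_1,\dots,a_n)\in\theta_\epsilon(\mathcal U)$, $|\mu(\phi(x,b))-\mathrm{Av}(a_1,\dots,a_n;\phi(x,b))|\le\epsilon$. *)

(* Defs.v *)
From HB Require Import structures.
From mathcomp Require Import all_boot all_order all_algebra.
From mathcomp Require Import all_classical all_reals all_analysis.

Set Implicit Arguments.
Unset Strict Implicit.
Unset Printing Implicit Defensive.

Import Order.TTheory GRing.Theory Num.Theory.
Import numFieldNormedType.Exports.

Local Open Scope classical_set_scope.
Local Open Scope ring_scope.

(** * First-order logic (one-sorted, with equality) *)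

Record language := Language {
  funs : Type;
  rels : Type;
  farity : funs -> nat;
  rarity : rels -> nat }.

(* [pointedType] only records that universes of structures are non-empty;
   the base point is not part of the language. *)
Record structure (L : language) := Structure {
  dom :> pointedType;
  fint : forall f : funs L, ('I_(farity f) -> dom) -> dom;
  rint : forall r : rels L, ('I_(rarity r) -> dom) -> Prop }.
Arguments fint {L} _ _ _.
Arguments rint {L} _ _ _.

Inductive term (L : language) (V : Type) : Type :=
| tvar of V
| tapp (f : funs L) of ('I_(farity f) -> term L V).

(* [formula L V]: L-formulas whose free variables are among the elements of V;
   the quantifier [fEx] binds the variable [None].
   A formula phi(x,y) with x, y tuples indexed by X, Y is a
   [formula L (X + Y)]; a formula over a parameter set A is a
   [formula L (X + A)] in which the elements of A are interpreted as
   themselves. *)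
Inductive formula (L : language) (V : Type) : Type :=
| fEq of term L V & term L V
| fRel (r : rels L) of ('I_(rarity r) -> term L V)
| fNot of formula L V
| fOr of formula L V & formula L V
| fEx of formula L (option V).

Arguments tvar {L V} _.
Arguments tapp {L V} _ _.
Arguments fEq {L V} _ _.
Arguments fRel {L V} _ _.
Arguments fNot {L V} _.
Arguments fOr {L V} _ _.
Arguments fEx {L V} _.

Definition fAnd (L : language) (V : Type) (phi psi : formula L V) :=
  fNot (fOr (fNot phi) (fNot psi)).

Fixpoint teval (L : language) (N : structure L) (V : Type) (v : V -> N)
    (t : term L V) : N :=
  match t with
  | tvar x => v x
  | tapp f ts => fint N f (fun i => teval v (ts i))
  end.

Definition ext_val (V D : Type) (v : V -> D) (d : D) : option V -> D :=
  fun o => if o is Some x then v x else d.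

Fixpoint sat (L : language) (N : structure L) (V : Type) (phi : formula L V)
    : (V -> N) -> Prop :=
  match phi with
  | fEq s t => fun v => teval v s = teval v t
  | fRel r ts => fun v => rint N r (fun i => teval v (ts i))
  | fNot p => fun v => ~ sat p v
  | fOr p q => fun v => sat p v \/ sat q v
  | fEx p => fun v => exists d : N, sat p (ext_val v d)
  end.

Fixpoint trename (L : language) (V W : Type) (h : V -> W) (t : term L V)
    : term L W :=
  match t with
  | tvar x => tvar (h x)
  | tapp f ts => tapp f (fun i => trename h (ts i))
  end.

Fixpoint rename (L : language) (V W : Type) (h : V -> W) (phi : formula L V)
    : formula L W :=
  match phi with
  | fEq s t => fEq (trename h s) (trename h t)
  | fRel r ts => fRel r (fun i => trename h (ts i))
  | fNot p => fNot (rename h p)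
  | fOr p q => fOr (rename h p) (rename h q)
  | fEx p => fEx (rename (omap h) p)
  end.

Definition join (V W D : Type) (v : V -> D) (w : W -> D) : V + W -> D :=
  fun s => match s with inl x => v x | inr y => w y end.

(* Regard an A-formula as a B-formula along a map of parameters e : A -> B. *)
Definition lift_params (L : language) (X A B : Type) (e : A -> B)
    (phi : formula L (X + A)) : formula L (X + B) :=
  rename (join inl (fun a => inr (e a))) phi.

(* phi(x, b), for phi(x, y) and a tuple b of parameters. *)
Definition inst (L : language) (X Y A : Type) (phi : formula L (X + Y))
    (b : Y -> A) : formula L (X + A) :=
  rename (join inl (fun y => inr (b y))) phi.

(* phi(x, d), for phi(x, y) with parameters and a tuple d of parameters. *)
Definition inst_snd (L : language) (X Y A : Type)
    (phi : formula L ((X + Y) + A)) (d : Y -> A) : formula L (X + A) :=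
  rename (join (join inl (fun y => inr (d y))) inr) phi.

Definition sentence (L : language) := formula L void.

Definition models (L : language) (N : structure L) (T : set (sentence L)) :=
  forall s, T s -> sat s (of_void N).

Definition complete_theory (L : language) (T : set (sentence L)) : Prop :=
  (exists N : structure L, models N T) /\
  forall s : sentence L,
    (forall N : structure L, models N T -> sat s (of_void N)) \/
    (forall N : structure L, models N T -> ~ sat s (of_void N)).

(* e exhibits N as (isomorphic to) an elementary substructure of U. *)
Definition elementary (L : language) (N U : structure L) (e : N -> U) : Prop :=
  forall (V : Type) (phi : formula L V) (v : V -> N),
    sat phi v <-> sat phi (fun x => e (v x)).

Definition automorphism (L : language) (U : structure L) (s : U -> U) : Prop :=
  [/\ bijective s,
      forall f ts, s (fint U f ts) = fint U f (fun i => s (ts i)) &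
      forall r ts, rint U r ts <-> rint U r (fun i => s (ts i))].

(** * Type spaces *)

(* Complete types in variables X over the parameters e : A -> N, that is,
   consistent with the elementary diagram of e in N. *)
Definition is_type (L : language) (N : structure L) (A : Type) (e : A -> N)
    (X : Type) (p : set (formula L (X + A))) : Prop :=
  (forall phi, p phi \/ p (fNot phi)) /\
  (forall (n : nat) (G : 'I_n -> formula L (X + A)), (forall i, p (G i)) ->
    exists a : X -> N, forall i, sat (G i) (join a e)).

Record tspace (L : language) (N : structure L) (A : Type) (e : A -> N)
    (X : Type) := TSpace {
  tset : set (formula L (X + A));
  tsetP : is_type e tset }.

Section TypeSpace.
Context (L : language) (N : structure L) (A : Type) (e : A -> N) (X : Type).
Local Notation S := (tspace e X).

Lemma tp_subproof (b : X -> N) :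
  is_type e [set phi : formula L (X + A) | sat phi (join b e)].
Proof.
split=> [phi|n G HG]; last by exists b.
by case: (pselect (sat phi (join b e))); [left|right].
Qed.

Definition tp (b : X -> N) : S := TSpace (tp_subproof b).

Definition clopen_of (phi : formula L (X + A)) : set S :=
  [set p | tset p phi].

Definition tspace_open : set_system S :=
  [set O | forall p, O p -> exists phi, clopen_of phi p /\ clopen_of phi `<=` O].

Lemma tspace_closed (p : S) phi psi chi :
  tset p phi -> tset p psi ->
  (forall v : X + A -> N, sat phi v -> sat psi v -> sat chi v) ->
  tset p chi.
Proof.
case: p => p [cp fp] /= pphi ppsi imp; case: (cp chi) => // pn; exfalso.
pose G (i : 'I_3) := nth phi [:: phi; psi; fNot chi] i.
have [|a Ga] := fp _ G; first by case=> -[|[|[|i]]].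
by apply: (Ga (Ordinal (isT : (2 < 3)%N))); apply: imp;
  [exact: (Ga ord0)|exact: (Ga (Ordinal (isT : (1 < 3)%N)))].
Qed.

Lemma tspace_and (p : S) phi psi :
  tset p (fAnd phi psi) <-> tset p phi /\ tset p psi.
Proof.
split=> [pa|[p1 p2]]; last first.
  by apply: (tspace_closed p1 p2) => v /= ? ? [|].
by split; apply: (tspace_closed pa pa) => v /= H _; apply: contrapT => nH;
  apply: H; [left|right].
Qed.

Lemma tspace_openT : tspace_open setT.
Proof.
move=> p _; pose chi : formula L (X + A) :=
  fEx (fEq (tvar None) (tvar None)).
by case: p => p Hp; case: (Hp.1 chi) => h; [exists chi|exists (fNot chi)].
Qed.

Lemma tspace_openI : setI_closed tspace_open.
Proof.
move=> O1 O2 o1 o2 p [p1 p2].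
have [f1 [pf1 s1]] := o1 p p1; have [f2 [pf2 s2]] := o2 p p2.
exists (fAnd f1 f2); split; first exact/tspace_and.
by move=> q /tspace_and[q1 q2]; split; [apply: s1|apply: s2].
Qed.

Lemma tspace_open_bigU (I : Type) (f : I -> set S) :
  (forall i, tspace_open (f i)) -> tspace_open (\bigcup_i f i).
Proof.
move=> of_ p [i _ fip]; have [phi [pphi sub]] := of_ i p fip.
by exists phi; split=> // q /sub fiq; exists i.
Qed.

HB.instance Definition _ := gen_eqMixin (tspace e X).
HB.instance Definition _ := gen_choiceMixin (tspace e X).
HB.instance Definition _ := isPointed.Build (tspace e X) (tp (fun=> point)).
HB.instance Definition _ := isOpenTopological.Build (tspace e X)
  tspace_openT tspace_openI tspace_open_bigU.

End TypeSpace.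

Notation borel_tspace e X := (g_sigma_algebraType (@open (tspace e X))).

Definition realized_in (L : language) (N : structure L) (A : Type)
    (e : A -> N) (X : Type) (p : tspace e X) (N' : structure L) (j : A -> N')
    : Prop :=
  exists a : X -> N', forall phi, tset p phi <-> sat phi (join a j).

(** * The monster model *)

(* |A| < |K|; the cardinal kappa is represented by a type K. *)
Definition small (K : Type) (T : Type) (A : set T) : Prop :=
  (A #<= [set: K])%card && ~~ ([set: K] #<= A)%card.

Definition saturated (K : Type) (L : language) (U : structure L) : Prop :=
  forall (A : set U), small K A ->
  forall (n : nat) (p : tspace (fun a : A => set_val a : U) 'I_n),
    exists b : 'I_n -> U, tp (fun a : A => set_val a : U) b = p.

Definition strongly_homogeneous (K : Type) (L : language) (U : structure L)
    : Prop :=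
  forall (A : set U) (f : A -> U), small K A ->
    (forall (V : Type) (phi : formula L V) (v : V -> A),
       sat phi (fun x => set_val (v x) : U) <-> sat phi (fun x => f (v x))) ->
  exists s : U -> U, automorphism s /\ forall a : A, s (set_val a) = f a.

(* kappa-saturated and strongly kappa-homogeneous, with kappa > |L| + aleph_0 *)
Definition monster (K : Type) (L : language) (U : structure L) : Prop :=
  [/\ small K [set: nat], small K [set: funs L] & small K [set: rels L]] /\
  saturated K U /\ strongly_homogeneous K U.

(** * Good extensions and uniform NIP *)

Definition good_extension (L : language) (M Ms : structure L) (j : M -> Ms)
    : Prop :=
  elementary j /\
  forall (n : nat) (p : tspace (fun a : M => a) 'I_n), realized_in p j.

Definition uniformly_NIP (L : language) (N : structure L) (k m : nat)
    (phi : formula L ('I_k + 'I_m)) : Prop :=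
  exists n : nat, ~ exists a : 'I_n -> 'I_k -> N,
    forall I : {set 'I_n}, exists y : 'I_m -> N,
      (forall i, i \in I -> sat phi (join (a i) y)) /\
      (forall i, i \notin I -> ~ sat phi (join (a i) y)).

(** * Keisler measures *)

Section Keisler.
Context (R : realType) (K : Type) (L : language) (U : structure L).

(* Global Keisler measures in variables X: finitely additive probability
   measures on formulas over U, up to equivalence in U. *)
Definition keisler (X : Type) (mu : formula L (X + U) -> R) : Prop :=
  [/\ forall phi psi,
        (forall a : X -> U, sat phi (join a id) <-> sat psi (join a id)) ->
        mu phi = mu psi,
      forall phi, 0 <= mu phi,
      forall phi, (forall a : X -> U, sat phi (join a id)) -> mu phi = 1 &
      forall phi psi,
        (forall a : X -> U, ~ (sat phi (join a id) /\ sat psi (join a id))) ->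
        mu (fOr phi psi) = mu phi + mu psi].

Definition regular_measure (N : Type) (e : N -> U) (Y : Type)
    (nu : probability (borel_tspace e Y) R) : Prop :=
  forall B : set (borel_tspace e Y), measurable B ->
    nu B = ereal_inf [set nu O | O in [set O : set (tspace e Y) |
                                        open O /\ B `<=` O]] /\
    nu B = ereal_sup [set nu C | C in [set C : set (tspace e Y) |
                                        compact C /\ C `<=` B]].

(* Integrals do not see the completion of nu, so the completion is not taken.
   nu is the regular Borel probability measure on S_Y(N) identified with the
   restriction to N of the global Keisler measure la. *)
Definition borel_restriction (N : Type) (e : N -> U) (Y : Type)
    (la : formula L (Y + U) -> R)
    (nu : probability (borel_tspace e Y) R) : Prop :=
  regular_measure nu /\
  forall psi : formula L (Y + N),
    nu (clopen_of (e := e) psi) = (la (lift_params e psi))%:E.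

Section OverM.
Context (M : structure L) (iM : M -> U).

Definition type_invariant (X : Type) (mu : formula L (X + U) -> R) : Prop :=
  forall (m : nat) (phi : formula L (X + 'I_m)) (b b' : 'I_m -> U),
    tp iM b = tp iM b' -> mu (inst phi b) = mu (inst phi b').

Definition definable (X : Type) (mu : formula L (X + U) -> R) : Prop :=
  type_invariant mu /\
  forall (m : nat) (phi : formula L (X + 'I_m)),
    exists F : tspace iM 'I_m -> R,
      continuous F /\ forall b : 'I_m -> U, F (tp iM b) = mu (inst phi b).

Definition finitely_satisfiable (X : Type) (mu : formula L (X + U) -> R)
    : Prop :=
  forall phi : formula L (X + U), 0 < mu phi ->
    exists a : X -> M, sat phi (join (fun x => iM (a x)) id).

(* r is the integral of f with respect to la|_N, where N is some small model
   containing M and the parameters of phi, and f (tp (d / N)) = mu (phi(x,d)).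
   (f is determined, as types over N are realized; for mu definable over M
   the value r does not depend on N.) *)
Definition morley_value (X Y : Type) (mu : formula L (X + U) -> R)
    (la : formula L (Y + U) -> R) (phi : formula L ((X + Y) + U)) (r : R)
    : Prop :=
  exists (N : structure L) (iN : N -> U),
    [/\ elementary iN, small K [set: N], range iM `<=` range iN &
        exists phiN : formula L ((X + Y) + N), phi = lift_params iN phiN] /\
    exists (nu : probability (borel_tspace iN Y) R)
           (f : tspace iN Y -> R),
      [/\ borel_restriction la nu,
          forall d : Y -> U, f (tp iN d) = mu (inst_snd phi d) &
          r = \int[nu]_q f q].

Definition morley_product (X Y : Type) (mu : formula L (X + U) -> R)
    (la : formula L (Y + U) -> R) : formula L ((X + Y) + U) -> R :=
  fun phi => get [set r : R | morley_value mu la phi r].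

(* Separates the last x_{n+1} from the tuple of tuples (x_1, ..., x_{n+1}). *)
Definition split_last (n : nat) (X : Type) (v : 'I_n.+1 * X)
    : X + 'I_n * X :=
  match unlift ord_max v.1 with
  | None => inl v.2
  | Some i => inr (i, v.2)
  end.

(* [morley_power mu n] is the Morley power mu^(n+1), in the variables
   (x_i)_(i : 'I_n.+1); mu^(n+2) is mu_{x_{n+2}} (x) mu^(n+1). *)
Fixpoint morley_power (X : Type) (mu : formula L (X + U) -> R) (n : nat)
    : formula L ('I_n.+1 * X + U) -> R :=
  match n with
  | 0 => fun phi => mu (rename (join (fun v => inl v.2) inr) phi)
  | n'.+1 => fun phi => morley_product mu (@morley_power X mu n')
               (rename (join (fun v => inl (split_last v)) inr) phi)
  end.

Definition Av (n : nat) (X Y : Type) (a : 'I_n -> X -> U)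
    (phi : formula L (X + Y)) (b : Y -> U) : R :=
  #|[pred i : 'I_n | `[< sat phi (join (a i) b) >]]|%:R / n%:R.

Definition fim (X : Type) (mu : formula L (X + U) -> R) : Prop :=
  type_invariant mu /\
  forall (m : nat) (phi : formula L (X + 'I_m)) (eps : R), 0 < eps ->
    exists (n : nat) (theta : formula L ('I_n.+1 * X + M)),
      1 - eps <= morley_power mu (lift_params iM theta) /\
      forall (b : 'I_m -> U) (a : 'I_n.+1 -> X -> U),
        sat theta (join (fun v => a v.1 v.2) iM) ->
        `| mu (inst phi b) - Av a phi b | <= eps.

End OverM.
End Keisler.

(* Main.v *)
Require Import Defs.
From mathcomp Require Import all_boot all_order all_algebra.

(* Being "uniformly NIP in Ms with bound n" is first order, so it transfers from
   Ms to M and to U: the theory is NIP, and the Vapnik-Chervonenkis law of large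
   numbers holds for all finitely supported measures, with sample sizes depending
   only on the formula and on epsilon.

   First, mu is uniformly approximated by averages over finite tuples of M.  If
   phi(x,y) were a counterexample, Blackwell's approachability argument would give,
   for every finite set A of points of M^k, finitely many b with
   phi(a,b) - mu(phi(x,b)) bounded below on average over b, for all a in A.  The
   law of large numbers for the dual formula makes the number of b independent of
   A, and by compactness (using definability of mu) and saturation a single tuple
   of b works for all a in M^k.  This contradicts finite satisfiability, since the
   mean over mu of phi(x,b) - mu(phi(x,b)) is zero.

   Next, by induction on n and definability, mu^(n)(psi) is the limit of the
   averages of psi over the n-tuples from finite samples approximating mu.  This
   also makes mu^(n) finitely additive on L(M)-formulas, hence the restriction of a
   regular Borel probability measure on the type space over M.

   Finally, definability gives an L(M)-formula theta saying that (x_1,...,x_n)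
   approximates mu on phi.  By the law of large numbers most n-tuples from a good
   sample satisfy theta, so mu^(n)(theta) is close to 1. *)

Set Implicit Arguments.
Unset Strict Implicit.
Unset Printing Implicit Defensive.

(** * The Vapnik-Chervonenkis law of large numbers *)

Section SauerShelah.
Variable T : finType.
Implicit Types (F : {set {set T}}) (S A B : {set T}).

Definition set_shatters F S :=
  [forall A : {set T}, (A \subset S) ==> [exists B in F, B :&: S == A]].

Lemma set_shattersP F S :
  reflect (forall A, A \subset S -> exists2 B, B \in F & B :&: S = A)
          (set_shatters F S).
Proof.
apply: (iffP forallP) => [H A AS|H A].
  have /implyP/(_ AS)/existsP[B /andP[BF /eqP e]] := H A.
  by exists B.
by apply/implyP => /H[B BF e]; apply/existsP; exists B; rewrite BF e eqxx.
Qed.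

Lemma sub_set_shatters F F' S :
  F \subset F' -> set_shatters F S -> set_shatters F' S.
Proof.
move=> /subsetP s /set_shattersP H; apply/set_shattersP => A /H[B BF e].
by exists B => //; exact: s.
Qed.

(** Induction on [#|F|]: split [F] by a point [x] on which two members differ. Sets shattered by
    either half omit [x], and a set [S] shattered by both halves makes [F] shatter [x |: S] as well.
    Hence the union and the intersection of the two shattered families inject into disjoint families
    of sets shattered by [F]. *)
Lemma pajor F : #|F| <= #|[set S | set_shatters F S]|.
Proof.
have [n] := ubnP #|F|; elim: n F => // n IH F; rewrite ltnS => Fn.
have [F1|] := leqP #|F| 1.
  have [->|[B BF]] := set_0Vmem F; first by rewrite cards0.
  apply: (leq_trans F1); rewrite card_gt0; apply/set0Pn; exists set0.
  rewrite inE; apply/set_shattersP => A.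
  by rewrite subset0 => /eqP ->; exists B => //; rewrite setI0.
move=> /card_gt1P[B1 [B2 [B1F B2F B12]]].
have [x xB] : exists x, (x \in B1) != (x \in B2).
  apply/existsP; rewrite -[[exists _, _]]negbK negb_exists; apply: contra B12.
  by move=> /forallP H; apply/eqP/setP => x; apply/eqP; have := H x; rewrite negbK.
pose F1 := [set B in F | x \in B]; pose F0 := [set B in F | x \notin B].
have cF : #|F| = #|F1| + #|F0|.
  by rewrite -(cardsID [set B : {set T} | x \in B] F); congr (_ + _);
    apply: eq_card => B; rewrite !inE // andbC.
have [F1F F0F] : F1 \subset F /\ F0 \subset F.
  by split; apply/subsetP => B; rewrite inE => /andP[].
have [F1p F0p] : 0 < #|F1| /\ 0 < #|F0|.
  rewrite !card_gt0; case x1: (x \in B1) xB; case x2: (x \in B2) => // _; split; apply/set0Pn;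
  by [exists B1; rewrite inE B1F x1|exists B2; rewrite inE B2F x2].
have l1 : #|F1| <= #|[set S | set_shatters F1 S]|.
  apply: IH; apply: leq_trans Fn; rewrite cF -[ltnLHS]addn0 ltn_add2l //.
have l0 : #|F0| <= #|[set S | set_shatters F0 S]|.
  apply: IH; apply: leq_trans Fn; rewrite cF -[ltnLHS]add0n ltn_add2r //.
rewrite cF; apply: (leq_trans (leq_add l1 l0)).
set S1 := [set S | set_shatters F1 S]; set S0 := [set S | set_shatters F0 S].
have xS1 S : S \in S1 -> x \notin S.
  rewrite inE => /set_shattersP H; apply/negP => xS.
  have [|B] := H (S :\ x); first exact: subD1set.
  rewrite inE => /andP[_ xB'] /setP/(_ x); rewrite !inE eqxx xS xB' //.
have xS0 S : S \in S0 -> x \notin S.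
  rewrite inE => /set_shattersP H; apply/negP => xS.
  have [|B] := H S; first exact: subxx.
  rewrite inE => /andP[_ /negbTE xB'] /setP/(_ x); rewrite !inE xS xB' //.
rewrite -cardsUI.
pose G := [set x |: S | S in S1 :&: S0].
have cG : #|G| = #|S1 :&: S0|.
  apply: card_in_imset => S S'; rewrite !inE => /andP[h _] /andP[h' _] e.
  have nx : x \notin S by apply: xS1; rewrite inE.
  have nx' : x \notin S' by apply: xS1; rewrite inE.
  by rewrite -(setU1K nx) -(setU1K nx') e.
rewrite -cG -[X in X <= _]cardsUI; set X := _ :&: G.
have -> : X = set0.
  apply/setP => S; rewrite [RHS]inE; apply/negP => /setIP[SU /imsetP[S' _ eS]].
  have xS : x \in S by rewrite eS setU11.
  by case/setUP: SU => [/xS1|/xS0]; rewrite xS.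
rewrite cards0 addn0; apply: subset_leq_card; apply/subsetP => S.
case/setUP=> [/setUP[]|].
- by rewrite !inE; exact: sub_set_shatters.
- by rewrite !inE; exact: sub_set_shatters.
case/imsetP => S' /setIP[S'1 S'0] ->{S}; have xS' := xS1 _ S'1.
move: S'1 S'0; rewrite !inE => /set_shattersP h1 /set_shattersP h0.
apply/set_shattersP => A AS.
have AS' : A :\ x \subset S' by rewrite subDset.
have [xA|xA] := boolP (x \in A).
  have [B] := h1 _ AS'; rewrite inE => /andP[BF xB'] e.
  exists B => //; apply/setP => y; move/setP/(_ y): e; rewrite !inE.
  by case: eqVneq => [->|] //=; rewrite xA xB'.
have [B] := h0 _ AS'; rewrite inE => /andP[BF xB'] e.
exists B => //; apply/setP => y; move/setP/(_ y): e; rewrite !inE.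
by case: eqVneq => [->|] //=; rewrite (negbTE xA) (negbTE xB').
Qed.

(** A set of at most [d] points is the range of a function ['I_d -> option T], with [None] as
    padding; hence the base [#|T|.+1]. *)
Lemma card_small_sets d :
  #|[set S : {set T} | #|S| <= d]| <= #|T|.+1 ^ d.
Proof.
have -> : #|T|.+1 ^ d = #|{ffun 'I_d -> option T}|.
  by rewrite card_ffun card_ord card_option.
pose im (f : {ffun 'I_d -> option T}) := [set y | [exists i, f i == Some y]].
suff sub : [set S : {set T} | #|S| <= d] \subset im @: setT.
  by rewrite (leq_trans (subset_leq_card sub)) // (leq_trans (leq_imset_card _ _)) ?cardsT.
apply/subsetP => S; rewrite inE => Sd.
apply/imsetP; exists [ffun i : 'I_d => nth None (map Some (enum S)) i] => //.
apply/setP => y; rewrite inE; apply/idP/existsP => [yS|[i]].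
  have yi : index y (enum S) < d.
    by apply: leq_trans Sd; rewrite cardE index_mem mem_enum.
  exists (Ordinal yi); rewrite ffunE /= (nth_map y) ?index_mem ?mem_enum //.
  by rewrite nth_index ?mem_enum.
rewrite ffunE => /eqP h; rewrite -mem_enum.
have [iS|iS] := ltnP i (size (enum S)); last by rewrite nth_default ?size_map in h.
by move: h; rewrite (nth_map y) // => -[<-]; rewrite mem_nth.
Qed.

Lemma sauer_shelah F d :
  (forall S, set_shatters F S -> #|S| <= d) -> #|F| <= #|T|.+1 ^ d.
Proof.
move=> H; apply: leq_trans (pajor F) (leq_trans _ (card_small_sets d)).
by apply/subset_leq_card/subsetP => S; rewrite !inE => /H.
Qed.

End SauerShelah.

Section Traces.
Variables (Om : finType) (CC : {set {set Om}}) (d : nat).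

Definition tuple_shattered (x : 'I_d -> Om) :=
  forall I : {set 'I_d}, exists2 C, C \in CC & forall i, (x i \in C) = (i \in I).

Definition trace n (x : 'I_n -> Om) (C : {set Om}) := [set i | x i \in C].

(** More than [d] indices shattered by the traces would include [d] distinct ones whose images under
    [x] form a shattered [d]-tuple, so Sauer-Shelah applies on ['I_n]. *)
Lemma card_traces n (x : 'I_n -> Om) :
  (forall y, ~ tuple_shattered y) -> #|trace x @: CC| <= n.+1 ^ d.
Proof.
move=> nsh; rewrite -[n in n.+1]card_ord; apply: sauer_shelah => S /set_shattersP sh.
rewrite leqNgt; apply/negP => dS.
have lt_d (i : 'I_d) : i < size (enum S) by rewrite -cardE (leq_trans (ltn_ord i)) // ltnW.
have [i0 _] : exists i0, i0 \in S by apply/card_gt0P; exact: leq_trans dS.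
pose s (i : 'I_d) := nth i0 (enum S) i.
have sS i : s i \in S by rewrite -mem_enum mem_nth.
have s_inj : injective s.
  move=> i j /eqP; rewrite /s nth_uniq ?enum_uniq // => /eqP.
  exact: val_inj.
apply: (nsh (x \o s)) => I.
have [|B /imsetP[C CC_ ->] e] := sh (s @: I).
  by apply/subsetP => _ /imsetP[i _ ->].
exists C => // i; move/setP/(_ (s i)): e; rewrite !inE /= sS andbT => ->.
by rewrite mem_imset.
Qed.

End Traces.

(* Imported only here because [all_classical] shadows lemmas of [finset]. *)
From HB Require Import structures.
From mathcomp Require Import all_classical all_reals all_analysis.
From mathcomp Require Import measurable_realfun finmap ring lra.
Import Order.TTheory GRing.Theory Num.Theory.
Import numFieldNormedType.Exports.
Local Open Scope ring_scope.

(** * Sums of random signs and the Chernoff bound *)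

Section Rademacher.
Variable R : realType.
Implicit Types (s delta : R).

(** For [0 <= s], inverting [1 + x <= expR x] at [x = - s] and [x = s] bounds the two exponentials
    by [1 + s + 2 s^2] and [1 - s + 2 s^2]. They add up to [2 (1 + 2 s^2)]. *)
Lemma expR_cosh_le s : `|s| <= 1 / 2 -> expR s + expR (- s) <= 2 * expR (2 * s ^+ 2).
Proof.
wlog s0 : s / 0 <= s => [H|].
  have [s0|/ltW s0] := leP 0 s; first exact: H.
  by rewrite -normrN => sl; have := H (- s); rewrite opprK sqrrN addrC oppr_ge0; exact.
rewrite ger0_norm // => s2.
have h1 : expR s <= 1 + s + 2 * s ^+ 2.
  rewrite -[s in leLHS]opprK expRN -[leRHS]invrK lef_pV2 ?posrE ?expR_gt0 ?invr_gt0 //; last nra.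
  apply: le_trans (expR_ge1Dx _); rewrite invf_ple ?posrE; [|nra|nra].
  rewrite -[leLHS]mul1r ler_pdivrMr; [nra|nra].
have h2 : expR (- s) <= 1 - s + 2 * s ^+ 2.
  rewrite expRN -[leRHS]invrK lef_pV2 ?posrE ?expR_gt0 ?invr_gt0 //; last nra.
  apply: le_trans (expR_ge1Dx _); rewrite invf_ple ?posrE; [|nra|nra].
  rewrite -[leLHS]mul1r ler_pdivrMr; [nra|nra].
have := expR_ge1Dx (2 * s ^+ 2); nra.
Qed.

Definition sg (b : bool) : R := (-1) ^+ b.

Lemma norm_sg b : `|sg b| = 1.
Proof. by rewrite /sg normrX normrN1 expr1n. Qed.

(** The signs are independent, so the sum over [e] factors over the indices; an index outside [T]
    contributes a factor 2. *)
Lemma rademacher_mgf n (T : {set 'I_n}) s : `|s| <= 1 / 2 ->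
  \sum_(e : {ffun 'I_n -> bool}) expR (s * \sum_(i in T) sg (e i))
  <= 2 ^+ n * expR (n%:R * (2 * s ^+ 2)).
Proof.
move=> s2.
pose G i b : R := if i \in T then expR (s * sg b) else 1.
have -> : \sum_(e : {ffun 'I_n -> bool}) expR (s * \sum_(i in T) sg (e i)) =
          \prod_i \sum_b G i b.
  rewrite bigA_distr_bigA; apply: eq_bigr => e _.
  by rewrite mulr_sumr expR_sum big_mkcond.
rewrite expRM_natl -exprMn -[n in leRHS]card_ord -prodr_const.
apply: ler_prod => i _; rewrite big_bool /G; case: ifP => _.
  by rewrite addr_ge0 ?expR_ge0 //= /sg expr0 expr1 mulr1 mulrN1 addrC expR_cosh_le.
by apply/andP; rewrite /=; split; [lra|have := expR_ge1Dx (2 * s ^+ 2); have := sqr_ge0 s; lra].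
Qed.

Definition rad n (F : {set {set 'I_n}}) (e : {ffun 'I_n -> bool}) : R :=
  \big[Num.max/0]_(T in F) `|\sum_(i in T) sg (e i)|.

(** Chernoff with a union bound over [F]. A signed sum is at most [n] in absolute value; when it
    exceeds [n delta], one of the two exponentials [E s T e], [E (- s) T e] is at least 1. *)
Lemma rad_le n (F : {set {set 'I_n}}) delta : 0 < delta <= 2 ->
  \sum_(e : {ffun 'I_n -> bool}) rad F e <=
  2 ^+ n * (n%:R * (delta + #|F|%:R * 2 * expR (- (n%:R * (delta ^+ 2 / 8))))).
Proof.
(* This [s] minimises the exponent [2 s^2 - s delta], with value [- delta^2 / 8]; [delta <= 2]
   ensures [s <= 1 / 2]. *)
move=> /andP[d0 d2]; pose s := delta / 4.
pose E (t : R) (T : {set 'I_n}) (e : {ffun 'I_n -> bool}) :=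
  expR (t * \sum_(i in T) sg (e i)) * expR (- (s * (n%:R * delta))).
have E0 t T e : 0 <= E t T e by rewrite mulr_ge0 ?expR_ge0.
have pt e : rad F e <= n%:R * delta + n%:R * \sum_(T in F) (E s T e + E (- s) T e).
  apply: bigmax_le => [|T TF].
    apply: addr_ge0; apply: mulr_ge0 => //; first exact: ltW.
    by apply: sumr_ge0 => T _; rewrite addr_ge0.
  set S := \sum_(i in T) _.
  have Sn : `|S| <= n%:R.
    apply: le_trans (ler_norm_sum _ _ _) _; under eq_bigr do rewrite norm_sg.
    by rewrite sumr_const ler_nat -[leqRHS]card_ord max_card.
  have [le|lt] := leP `|S| (n%:R * delta).
    apply: le_trans le _; rewrite lerDl mulr_ge0 ?ler0n // sumr_ge0 // => T' _.
    by rewrite addr_ge0.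
  have s0 : 0 < s by rewrite divr_gt0.
  have one : 1 <= E s T e + E (- s) T e.
    have ge1 x : 0 <= x -> 1 <= expR x by rewrite -expR0 ler_expR.
    rewrite /E -!expRD -/S; move: lt; rewrite ltr_normr => /orP[] lt.
      apply: (le_trans (y := expR (s * S - s * (n%:R * delta)))); last first.
        by rewrite lerDl expR_ge0.
      by apply: ge1; rewrite -mulrBr mulr_ge0 ?(ltW s0) // subr_ge0 ltW.
    apply: (le_trans (y := expR (- s * S - s * (n%:R * delta)))); last first.
      by rewrite lerDr expR_ge0.
    by apply: ge1; rewrite mulNr -mulrN -mulrBr mulr_ge0 ?(ltW s0) // subr_ge0 ltW.
  apply: le_trans Sn _; rewrite -[leLHS]add0r; apply: lerD.
    by rewrite mulr_ge0 ?ler0n ?ltW.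
  rewrite ler_peMr ?ler0n // (bigD1 T) //= -[leLHS]addr0 lerD // sumr_ge0 // => T' _.
  by rewrite addr_ge0.
apply: le_trans (ler_sum _ (fun e _ => pt e)) _.
rewrite big_split /= sumr_const card_ffun card_bool card_ord -mulr_sumr exchange_big /=.
set q := expR (- (n%:R * (delta ^+ 2 / 8))).
have -> : 2 ^+ n * (n%:R * (delta + #|F|%:R * 2 * q)) =
   n%:R * delta *+ 2 ^ n + n%:R * (#|F|%:R * (2 * (2 ^+ n * q))).
  by rewrite -[X in _ = X + _]mulr_natr natrX; ring.
rewrite lerD2l ler_wpM2l ?ler0n // mulr_natl -sumr_const.
have sl : `|s| <= 1 / 2 by rewrite /s ger0_norm; [lra|rewrite divr_ge0 ?ltW].
have aux t T : `|t| <= 1 / 2 -> t ^+ 2 = s ^+ 2 -> \sum_e E t T e <= 2 ^+ n * q.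
  move=> tl t2; rewrite -mulr_suml.
  apply: le_trans (ler_wpM2r (expR_ge0 _) (rademacher_mgf T tl)) _.
  rewrite -mulrA -expRD t2 ler_wpM2l ?exprn_ge0 // ler_expR /s le_eqVlt; apply/orP; left.
  by apply/eqP; field.
apply: ler_sum => T _; rewrite big_split /= [leRHS]mulr_natl [leRHS]mulr2n.
by apply: lerD; apply: aux; rewrite ?normrN ?sqrrN.
Qed.

End Rademacher.

(** * Independent samples from a finite probability space, and symmetrization *)

Section ProductWeights.
Variables (R : realType) (Om : finType) (p : Om -> R).
Hypotheses (p0 : forall a, 0 <= p a) (p1 : \sum_a p a = 1).

(** The law of [n] independent draws of law [p]; sums weighted by it are expectations. *)
Definition pweight n (x : {ffun 'I_n -> Om}) : R := \prod_i p (x i).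

Lemma pweight_ge0 n (x : {ffun 'I_n -> Om}) : 0 <= pweight x.
Proof. exact: prodr_ge0. Qed.

Lemma sum_pweight n : \sum_(x : {ffun 'I_n -> Om}) pweight x = 1.
Proof.
rewrite -(bigA_distr_bigA (fun=> p)) big1 // => i _; exact: p1.
Qed.

Lemma expect_coord n (g : Om -> R) (i : 'I_n) :
  \sum_(x : {ffun 'I_n -> Om}) pweight x * g (x i) = \sum_a p a * g a.
Proof.
pose F j a : R := p a * (if j == i then g a else 1).
have -> : \sum_(x : {ffun 'I_n -> Om}) pweight x * g (x i) =
          \sum_(x : {ffun 'I_n -> Om}) \prod_j F j (x j).
  apply: eq_bigr => x _; rewrite big_split /=; congr (_ * _).
  by rewrite -big_mkcond big_pred1_eq.
rewrite -bigA_distr_bigA (bigD1 i) //= [X in _ * X]big1 ?mulr1 => [|j ji]; last first.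
  rewrite /F (negbTE ji) -[RHS]p1; apply: eq_bigr => a _; exact: mulr1.
by apply: eq_bigr => a _; rewrite /F eqxx.
Qed.

Lemma expect_sum_coord n (g : Om -> R) :
  \sum_(x : {ffun 'I_n -> Om}) pweight x * (\sum_i g (x i)) =
  n%:R * \sum_a p a * g a.
Proof.
under eq_bigr do rewrite mulr_sumr.
rewrite exchange_big /=; under eq_bigr do rewrite expect_coord.
by rewrite sumr_const card_ord mulr_natl.
Qed.

Lemma markov_pweight n (g : {ffun 'I_n -> Om} -> R) (c : R) : 0 < c ->
  (forall x, 0 <= g x) ->
  \sum_(x | c <= g x) pweight x <= (\sum_x pweight x * g x) / c.
Proof.
move=> c0 g0; rewrite ler_pdivlMr // mulr_suml big_mkcond.
apply: ler_sum => x _; case: ifP => [cg|_]; first by rewrite ler_wpM2l ?pweight_ge0.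
by rewrite mulr_ge0 ?pweight_ge0.
Qed.

Variable CC : {set {set Om}}.

Definition hits n (x : {ffun 'I_n -> Om}) (C : {set Om}) : R := #|trace x C|%:R.

Definition mass (C : {set Om}) : R := \sum_(a in C) p a.

Definition deviation n (x : {ffun 'I_n -> Om}) : R :=
  \big[Num.max/0]_(C in CC) `|hits x C - n%:R * mass C|.

Lemma hitsE n (x : {ffun 'I_n -> Om}) C : hits x C = \sum_i (x i \in C)%:R.
Proof.
rewrite /hits -sum1_card natr_sum big_mkcond /=.
by apply: eq_bigr => i _; rewrite inE; case: (_ \in _).
Qed.

Lemma expect_hits n C : \sum_(x : {ffun 'I_n -> Om}) pweight x * hits x C = n%:R * mass C.
Proof.
under eq_bigr do rewrite hitsE.
rewrite (expect_sum_coord _ (fun a => (a \in C)%:R)); congr (_ * _).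
by rewrite /mass [RHS]big_mkcond; apply: eq_bigr => a _; case: (_ \in _); rewrite ?mulr1 ?mulr0.
Qed.

Lemma bigmax_norm_ge0 (I : finType) (P : pred I) (F : I -> R) :
  0 <= \big[Num.max/0]_(i | P i) `|F i|.
Proof. by elim/big_ind : _ => // a b a0 b0; rewrite le_max a0. Qed.

(** [n mass C] is the expected number of hits of a second, independent sample [y]. The norm and the
    maximum over [C] may then be moved inside the expectation over [y]. *)
Lemma deviation_ghost n (x : {ffun 'I_n -> Om}) :
  deviation x <= \sum_(y : {ffun 'I_n -> Om}) pweight y *
     \big[Num.max/0]_(C in CC) `|hits x C - hits y C|.
Proof.
apply: bigmax_le => [|C CC_].
  by apply: sumr_ge0 => y _; rewrite mulr_ge0 ?pweight_ge0 ?bigmax_norm_ge0.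
have -> : hits x C - n%:R * mass C = 
   \sum_(y : {ffun 'I_n -> Om}) pweight y * (hits x C - hits y C).
  under eq_bigr do rewrite mulrBr.
  by rewrite sumrB expect_hits -mulr_suml sum_pweight mul1r.
apply: le_trans (ler_norm_sum _ _ _) _; apply: ler_sum => y _.
rewrite normrM ger0_norm ?pweight_ge0 // ler_wpM2l ?pweight_ge0 //.
exact: le_bigmax_cond.
Qed.

(* Exchanging the coordinates of two independent samples does not change
   their joint law, hence random signs may be inserted. *)
Lemma ghost_swap n (e : {ffun 'I_n -> bool}) :
  \sum_(x : {ffun 'I_n -> Om}) \sum_(y : {ffun 'I_n -> Om}) pweight x * pweight y *
     \big[Num.max/0]_(C in CC) `|hits x C - hits y C| =
  \sum_(x : {ffun 'I_n -> Om}) \sum_(y : {ffun 'I_n -> Om}) pweight x * pweight y *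
     \big[Num.max/0]_(C in CC)
        `|\sum_(i in trace x C) sg R (e i) - \sum_(i in trace y C) sg R (e i)|.
Proof.
pose sw (z : {ffun 'I_n -> Om} * {ffun 'I_n -> Om}) :=
  ([ffun i => if e i then z.2 i else z.1 i], [ffun i => if e i then z.1 i else z.2 i]).
have swK : involutive sw.
  by case=> x y; congr (_, _); apply/ffunP => i; rewrite !ffunE /= ?ffunE; case: (e i).
rewrite !pair_big /= (reindex_inj (inv_inj swK)) /=.
apply: eq_bigr => -[x y] _ /=; congr (_ * _).
  rewrite /pweight -!big_split /=; apply: eq_bigr => i _; rewrite !ffunE.
  by case: (e i) => //; rewrite mulrC.
apply: eq_bigr => C _; congr (`| _ |); rewrite !hitsE.
rewrite [in RHS]big_mkcond [X in _ = _ - X]big_mkcond -!sumrB; apply: eq_bigr => i _.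
rewrite !ffunE !inE /sg; case: (e i); rewrite ?expr0 ?expr1;
by case: (_ \in _); case: (_ \in _); rewrite ?subrr ?subr0 ?sub0r ?opprK.
Qed.

(** After the swap, the triangle inequality separates the signed sums of the two samples, which have
    the same expectation; hence the factor 2. *)
Lemma deviation_symm n (e : {ffun 'I_n -> bool}) :
  \sum_(x : {ffun 'I_n -> Om}) pweight x * deviation x <=
  2 * \sum_(x : {ffun 'I_n -> Om}) pweight x * rad R (trace x @: CC) e.
Proof.
have rE x : rad R (trace x @: CC) e =
   \big[Num.max/0]_(C in CC) `|\sum_(i in trace x C) sg R (e i)|.
  apply/eqP; rewrite eq_le; apply/andP; split; apply: bigmax_le; rewrite ?bigmax_norm_ge0 //.
    by move=> _ /imsetP[C CC_ ->]; exact: le_bigmax_cond.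
  by move=> C CC_; apply: le_bigmax_cond; exact: imset_f.
apply: (@le_trans _ _ (\sum_(x : {ffun 'I_n -> Om}) \sum_(y : {ffun 'I_n -> Om})
     pweight x * pweight y * \big[Num.max/0]_(C in CC) `|hits x C - hits y C|)).
  apply: ler_sum => x _; under eq_bigr do rewrite -mulrA.
  by rewrite -mulr_sumr ler_wpM2l ?pweight_ge0 ?deviation_ghost.
rewrite (ghost_swap e).
apply: (@le_trans _ _ (\sum_(x : {ffun 'I_n -> Om}) \sum_(y : {ffun 'I_n -> Om})
     pweight x * pweight y * (rad R (trace x @: CC) e + rad R (trace y @: CC) e))).
  apply: ler_sum => x _; apply: ler_sum => y _.
  rewrite ler_wpM2l ?mulr_ge0 ?pweight_ge0 //.
  apply: bigmax_le => [|C CC_]; first by rewrite addr_ge0 // bigmax_norm_ge0.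
  apply: le_trans (ler_normB _ _) _; rewrite !rE.
  by apply: lerD; exact: le_bigmax_cond.
under eq_bigr do under eq_bigr do rewrite mulrDr.
under eq_bigr do rewrite big_split /=.
rewrite big_split /= mulr2n mulrDl mul1r; apply: lerD.
  apply: ler_sum => x _; under eq_bigr do rewrite mulrAC.
  by rewrite -mulr_sumr sum_pweight mulr1.
rewrite exchange_big /=; apply: ler_sum => y _; under eq_bigr do rewrite -mulrA.
by rewrite -mulr_suml sum_pweight mul1r.
Qed.

(** Averaging [deviation_symm] over all [2 ^ n] sign vectors brings in the mean of [rad]. The family
    of traces to which [rad_le] is applied has polynomial size by [card_traces]. *)
Lemma expect_deviation_le n d delta : 0 < delta <= 2 ->
  (forall y : 'I_d -> Om, ~ tuple_shattered CC y) ->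
  \sum_(x : {ffun 'I_n -> Om}) pweight x * deviation x <=
  2 * (n%:R * (delta + (n.+1 ^ d)%:R * 2 * expR (- (n%:R * (delta ^+ 2 / 8))))).
Proof.
move=> dl nsh; set B := n%:R * _.
have -> : 2 * B = (2 * (2 ^+ n * B)) / 2 ^+ n.
  by rewrite [X in _ = X / _]mulrCA [RHS]mulrC mulKf // expf_neq0.
rewrite ler_pdivlMr ?exprn_gt0 // mulrC.
set D := \sum_x _.
have : \sum_(e : {ffun 'I_n -> bool}) D <=
       \sum_e 2 * \sum_(x : {ffun 'I_n -> Om}) pweight x * rad R (trace x @: CC) e.
  by apply: ler_sum => e _; exact: deviation_symm.
rewrite sumr_const card_ffun card_bool card_ord -[X in X <= _]mulr_natl natrX.
move/le_trans; apply; rewrite -mulr_sumr ler_wpM2l // exchange_big /=.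
apply: (@le_trans _ _ (\sum_(x : {ffun 'I_n -> Om}) pweight x * (2 ^+ n * B))); last first.
  by rewrite -mulr_suml sum_pweight mul1r.
apply: ler_sum => x _; rewrite -mulr_sumr ler_wpM2l ?pweight_ge0 //.
apply: le_trans (rad_le _ dl) _; rewrite ler_wpM2l ?exprn_ge0 // ler_wpM2l ?ler0n //.
rewrite lerD2l ler_wpM2r ?expR_ge0 // ler_wpM2r // ler_nat; exact: card_traces.
Qed.

End ProductWeights.

(** The Taylor term of degree [d.+1] of the exponential exceeds a polynomial of degree [d] by a
    factor linear in [n]; [n.+2] is bounded by twice [n.+1]. *)
Lemma poly_expR_small (R : realType) d (c kappa : R) : 0 < c -> 0 < kappa ->
  exists n, (n.+2 ^ d)%:R * 2 * expR (- (n.+1%:R * c)) <= kappa.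
Proof.
move=> c0 k0; pose Kc := 2 * 2 ^+ d * (d.+1)`!%:R / c ^+ d.+1.
have [n Hn] : exists n, Kc / kappa <= n.+1%:R.
  exists (Num.truncn (Kc / kappa)); apply: ltW; exact: truncnS_gt.
exists n; set m := n.+1%:R : R.
have m1 : 1 <= m by rewrite ler1n.
have m0 : 0 < m by rewrite ltr0n.
have hexp : m ^+ d.+1 * c ^+ d.+1 / (d.+1)`!%:R <= expR (m * c).
  have := expR_ge1Dxn d (mulr_ge0 (ltW m0) (ltW c0)).
  by rewrite exprMn; apply: le_trans; rewrite lerDr.
have f0 : 0 < (d.+1)`!%:R :> R by rewrite ltr0n fact_gt0.
have q0 : 0 < m ^+ d.+1 * c ^+ d.+1 / (d.+1)`!%:R.
  by rewrite divr_gt0 // mulr_gt0 // exprn_gt0.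
rewrite expRN; apply: (@le_trans _ _ ((2 * m) ^+ d * 2 / (m ^+ d.+1 * c ^+ d.+1 / (d.+1)`!%:R))).
  apply: ler_pM; rewrite ?invr_ge0 ?expR_ge0 // ?mulr_ge0 ?ler0n //.
    rewrite ler_wpM2r // natrX lerXn2r ?nnegrE ?ler0n ?mulr_ge0 ?(ltW m0) //.
    by rewrite -natr1 -/m; lra.
  by rewrite lef_pV2 ?posrE ?expR_gt0.
rewrite ler_pdivrMr // in Hn.
have -> : (2 * m) ^+ d * 2 / (m ^+ d.+1 * c ^+ d.+1 / (d.+1)`!%:R) = Kc / m.
  rewrite /Kc exprMn exprS; field; rewrite ?gt_eqF ?exprn_gt0 //.
by rewrite ler_pdivrMr // mulrC.
Qed.

(** Markov's inequality applied to the expected deviation. The sample size is chosen before the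
    space, its weights and the set system, and later arguments rely on this uniformity. *)
Theorem vc_uniform_law (R : realType) d (eps eta : R) : 0 < eps -> 0 < eta ->
  exists n, forall (Om : finType) (p : Om -> R) (CC : {set {set Om}}),
  (forall a, 0 <= p a) -> \sum_a p a = 1 ->
  (forall y : 'I_d -> Om, ~ tuple_shattered CC y) ->
  \sum_(x : {ffun 'I_n.+1 -> Om} |
     [exists C in CC, eps <= `|hits R x C / n.+1%:R - mass p C|]) pweight p x <= eta.
Proof.
(* Both [delta] and the exponential term are made at most [eps eta / 4], so the expected deviation
   is at most [n.+1 eps eta]; the minimum with 2 meets the range required by [rad_le]. *)
move=> e0 eta0; pose delta : R := Num.min 2 (eps * eta / 4).
have ee : 0 < eps * eta by rewrite mulr_gt0.
have d0 : 0 < delta by rewrite lt_min ltr0n divr_gt0.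
have d2 : delta <= 2 by rewrite ge_min lexx.
have d4 : delta <= eps * eta / 4 by rewrite ge_min lexx orbT.
have c0 : 0 < delta ^+ 2 / 8 by rewrite divr_gt0 ?exprn_gt0.
have k0 : 0 < eps * eta / 4 by rewrite divr_gt0.
have [n Hn] := poly_expR_small d c0 k0.
exists n => Om p CC p0 p1 nsh.
have n0 : 0 < n.+1%:R :> R by rewrite ltr0n.
have H := @expect_deviation_le R Om p p0 p1 CC n.+1 d delta (introT andP (conj d0 d2)) nsh.
have M := @markov_pweight R Om p p0 n.+1 (fun x => deviation p CC x) (n.+1%:R * eps).
apply: (@le_trans _ _ (\sum_(x | n.+1%:R * eps <= deviation p CC x) pweight p x)).
  rewrite [leLHS]big_mkcond [leRHS]big_mkcond; apply: ler_sum => x _.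
  case: ifP => [/existsP[C /andP[CC_ h]]|_]; last by case: ifP => _ //; exact: pweight_ge0.
  rewrite ifT //; apply: le_trans (le_bigmax_cond _ _ CC_).
  have -> : hits R x C - n.+1%:R * mass p C = n.+1%:R * (hits R x C / n.+1%:R - mass p C).
    by rewrite mulrBr mulrCA divff ?mulr1 ?gt_eqF.
  by rewrite normrM ger0_norm ?(ltW n0) // ler_wpM2l ?(ltW n0).
apply: le_trans (M _ _) _; rewrite ?mulr_gt0 //; first by move=> x; exact: bigmax_norm_ge0.
rewrite ler_pdivrMr ?mulr_gt0 //; apply: le_trans H _.
rewrite (mulrCA 2) [leRHS]mulrCA ler_wpM2l ?(ltW n0) //.
move: Hn d4; move: (_ * expR _) => q Hn d4; lra.
Qed.

(** * Formulas and definability *)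

Section Renaming.
Variable L : language.

Lemma trename_comp V W Z (g : W -> Z) (h : V -> W) (t : term L V) :
  trename g (trename h t) = trename (g \o h) t.
Proof. by elim: t => [//|f ts IH] /=; congr tapp; apply/funext => i; exact: IH. Qed.

Lemma rename_comp V W Z (g : W -> Z) (h : V -> W) (phi : formula L V) :
  rename g (rename h phi) = rename (g \o h) phi.
Proof.
elim: phi W Z g h => {V} [V s t|V r ts|V p IH|V p IHp q IHq|V p IH] W Z g h /=.
- by rewrite !trename_comp.
- by congr fRel; apply/funext => i; exact: trename_comp.
- by rewrite IH.
- by rewrite IHp IHq.
- by rewrite IH; congr (fEx (rename _ _)); apply/funext => -[].
Qed.

Lemma trename_id V (t : term L V) : trename id t = t.
Proof. by elim: t => [//|f ts IH] /=; congr tapp; apply/funext => i; exact: IH. Qed.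

Lemma rename_id V (phi : formula L V) : rename id phi = phi.
Proof.
elim: phi => {V} [V s t|V r ts|V p IH|V p IHp q IHq|V p IH] /=.
- by rewrite !trename_id.
- by congr fRel; apply/funext => i; exact: trename_id.
- by rewrite IH.
- by rewrite IHp IHq.
- by rewrite (_ : omap id = id) ?IH //; apply/funext => -[].
Qed.

Lemma teval_trename (N : structure L) V W (h : V -> W) (t : term L V) (v : W -> N) :
  teval v (trename h t) = teval (v \o h) t.
Proof. by elim: t => [//|f ts IH] /=; congr fint; apply/funext => i; exact: IH. Qed.

Lemma sat_rename (N : structure L) V W (h : V -> W) (phi : formula L V) (v : W -> N) :
  sat (rename h phi) v <-> sat phi (v \o h).
Proof.
elim: phi W h v => {V} [V s t|V r ts|V p IH|V p IHp q IHq|V p IH] W h v /=.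
- by rewrite !teval_trename.
- by under eq_fun do rewrite teval_trename.
- by rewrite IH.
- by rewrite IHp IHq.
- have e d : ext_val v d \o omap h = ext_val (v \o h) d by apply/funext => -[].
  by split=> -[d Hd]; exists d; move: Hd; rewrite IH e.
Qed.

Lemma sat_fAnd (N : structure L) V (phi psi : formula L V) (v : V -> N) :
  sat (fAnd phi psi) v <-> sat phi v /\ sat psi v.
Proof.
split=> /= [H|[p q] [|]//].
by split; apply: contrapT => n; apply: H; [left|right].
Qed.

Definition finitely_supported V (phi : formula L V) :=
  exists (F : finType) (g : F -> V) (phi0 : formula L F), phi = rename g phi0.

Lemma term_finitely_supported V (t : term L V) :
  exists (F : finType) (g : F -> V) (t0 : term L F), t = trename g t0.
Proof.
elim: t => [v|f ts IH]; first by exists unit, (fun=> v), (tvar tt).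
have IH' i : {F : finType & {g : F -> V & {t0 : term L F | ts i = trename g t0}}}.
  by have [F /cid[g /cid[t0 H]]] := cid (IH i); exists F, g, t0.
pose F i := projT1 (IH' i).
exists {i : 'I_(farity f) & F i}, (fun z => projT1 (projT2 (IH' (tag z))) (tagged z)),
  (tapp f (fun i => trename (fun x => Tagged F x) (sval (projT2 (projT2 (IH' i)))))).
rewrite /=; congr tapp; apply/funext => i; rewrite trename_comp.
exact: (svalP (projT2 (projT2 (IH' i)))).
Qed.

Lemma formula_finitely_supported V (phi : formula L V) : finitely_supported phi.
Proof.
elim: phi => {V} [V s t|V r ts|V p|V p [F1 [g1 [p1 ->]]] q [F2 [g2 [p2 ->]]]|V p].
- have [F1 [g1 [t1 ->]]] := term_finitely_supported s.
  have [F2 [g2 [t2 ->]]] := term_finitely_supported t.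
  exists (F1 + F2)%type, (fun z => match z with inl x => g1 x | inr x => g2 x end),
     (fEq (trename inl t1) (trename inr t2)).
  by rewrite /= !trename_comp.
- have IH' i : {F : finType & {g : F -> V & {t0 : term L F | ts i = trename g t0}}}.
    by have [F /cid[g /cid[t0 H]]] := cid (term_finitely_supported (ts i)); exists F, g, t0.
  pose F i := projT1 (IH' i).
  exists {i : 'I_(rarity r) & F i}, (fun z => projT1 (projT2 (IH' (tag z))) (tagged z)),
    (fRel r (fun i => trename (fun x => Tagged F x) (sval (projT2 (projT2 (IH' i)))))).
  rewrite /=; congr fRel; apply/funext => i; rewrite trename_comp.
  exact: (svalP (projT2 (projT2 (IH' i)))).
- by case=> F [g [p0 ->]]; exists F, g, (fNot p0).
- exists (F1 + F2)%type, (fun z => match z with inl x => g1 x | inr x => g2 x end),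
     (fOr (rename inl p1) (rename inr p2)).
  by rewrite /= !rename_comp.
(* Several elements of [F] may name the bound variable: [F'] keeps those that name a free one, and
   [insub] sends the others to [None]. *)
- case=> F [g [p0 ->]]; pose F' := {x : F | isSome (g x)}.
  have /choice[g' Hg'] : forall x : F', exists v, g (val x) = Some v.
    by move=> [x /=]; case: (g x) => // v _; exists v.
  exists F', g', (fEx (rename insub p0)); rewrite /= rename_comp.
  congr (fEx (rename _ _)); apply/funext => x /=.
  case: insubP => [y _ <-|]; first by rewrite Hg'.
  by case: (g x).
Qed.

(** Brings formulas with arbitrary parameters into the form [phi(x, b)] with [b] a finite tuple, to
    which definability applies. Variables of [F] lying in [X] also receive an index, with dummy
    parameter [a0]. *)
Lemma parameters_finite (X A : Type) (a0 : A) (phi : formula L (X + A)) :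
  exists m (b : 'I_m -> A) (phi0 : formula L (X + 'I_m)), phi = inst phi0 b.
Proof.
have [F [g [p ->]]] := formula_finitely_supported phi.
pose h (x : F) : X + 'I_#|F| :=
  match g x with inl x0 => inl x0 | inr _ => inr (enum_rank x) end.
exists #|F|, (fun i => match g (enum_val i) with inr a => a | inl _ => a0 end).
exists (rename h p); rewrite /inst rename_comp; congr rename; apply/funext => x.
rewrite /h /=; case E: (g x) => //=.
by rewrite enum_rankK E.
Qed.

End Renaming.

(* Predicates of valuations which are defined, uniformly in the structure, by
   a formula; closure properties of this class replace explicit formulas. *)
Definition expressible (L : language) (V : Type)
    (Q : forall N : structure L, (V -> N) -> Prop) :=
  exists phi : formula L V, forall N v, sat (N := N) phi v <-> Q N v.

Section Expressible.
Variable L : language.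
Implicit Type V : Type.

Lemma expressible_sat V W (phi : formula L V) (h : V -> W) :
  expressible (fun (N : structure L) (v : W -> N) => sat phi (fun x => v (h x))).
Proof. by exists (rename h phi) => N v; exact: sat_rename. Qed.

Lemma expressible_eq V (x y : V) :
  expressible (fun (N : structure L) (v : V -> N) => v x = v y).
Proof. by exists (fEq (tvar x) (tvar y)). Qed.

Lemma expressible_rename V W (Q : forall N : structure L, (V -> N) -> Prop) (h : V -> W) :
  expressible Q -> expressible (fun (N : structure L) (v : W -> N) => Q N (fun x => v (h x))).
Proof.
by case=> phi H; exists (rename h phi) => N v; rewrite sat_rename; exact: H.
Qed.

Lemma expressible_ext V (Q Q' : forall N : structure L, (V -> N) -> Prop) :
  (forall N v, Q N v <-> Q' N v) -> expressible Q -> expressible Q'.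
Proof. by move=> e [phi H]; exists phi => N v; rewrite -e H. Qed.

Lemma expressible_not V (Q : forall N : structure L, (V -> N) -> Prop) :
  expressible Q -> expressible (fun N v => ~ Q N v).
Proof. by case=> phi H; exists (fNot phi) => N v /=; rewrite H. Qed.

Lemma expressible_or V (Q Q' : forall N : structure L, (V -> N) -> Prop) :
  expressible Q -> expressible Q' -> expressible (fun N v => Q N v \/ Q' N v).
Proof. by case=> phi H [phi' H']; exists (fOr phi phi') => N v /=; rewrite H H'. Qed.

Lemma expressible_and V (Q Q' : forall N : structure L, (V -> N) -> Prop) :
  expressible Q -> expressible Q' -> expressible (fun N v => Q N v /\ Q' N v).
Proof.
by case=> phi H [phi' H']; exists (fAnd phi phi') => N v; rewrite sat_fAnd H H'.
Qed.

Lemma expressible_prop V (P : Prop) : expressible (fun (N : structure L) (v : V -> N) => P).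
Proof.
have [p|np] := pselect P.
  exists (fEx (fEq (tvar None) (tvar None))) => N v; split=> //= _.
  by exists point.
exists (fNot (fEx (fEq (tvar None) (tvar None)))) => N v; split=> //= H.
by case: H; exists point.
Qed.

Lemma expressible_forall (I : finType) V
    (Q : I -> forall N : structure L, (V -> N) -> Prop) :
  (forall i, expressible (Q i)) -> expressible (fun N v => forall i, Q i N v).
Proof.
move=> H.
suff [phi Hphi] : expressible (fun N v => forall i, i \in enum I -> Q i N v).
  by exists phi => N v; rewrite Hphi; split=> h i; [apply: h; rewrite mem_enum|move=> _].
elim: (enum I) => [|i s IH].
  by apply: expressible_ext (expressible_prop V True) => N v; split.
apply: expressible_ext (expressible_and (H i) IH) => N v; split.
  by move=> [h1 h2] i'; rewrite inE => /orP[/eqP ->|/h2].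
by move=> h; split=> [|i' i's]; apply: h; rewrite inE ?eqxx ?i's ?orbT.
Qed.

Lemma expressible_exists (I : finType) V
    (Q : I -> forall N : structure L, (V -> N) -> Prop) :
  (forall i, expressible (Q i)) -> expressible (fun N v => exists i, Q i N v).
Proof.
move=> H.
apply: expressible_ext (expressible_not (expressible_forall (fun i => expressible_not (H i)))) => N v.
split=> [h|[i q] /(_ i)//]; apply: contrapT => h'; apply: h => i q.
by apply: h'; exists i.
Qed.

(** A disjunction over the finitely many sets [J] with [G J]. As [G] is an arbitrary external
    predicate, this covers conditions on frequencies. *)
Lemma expressible_pattern (I : finType) V
    (Q : I -> forall N : structure L, (V -> N) -> Prop) (G : {set I} -> Prop) :
  (forall i, expressible (Q i)) ->
  expressible (fun N v => G [set i | `[< Q i N v >]]).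
Proof.
move=> H.
pose Q' (J : {set I}) (N : structure L) (v : V -> N) :=
  G J /\ forall i, if i \in J then Q i N v else ~ Q i N v.
have : expressible (fun N v => exists J, Q' J N v).
  apply: expressible_exists => J; apply: expressible_and; first exact: expressible_prop.
  by apply: expressible_forall => i; case: (i \in J) => //; exact: expressible_not.
apply: expressible_ext => N v; split=> [[J [GJ HJ]]|GJ].
  suff <- : J = [set i | `[< Q i N v >]] by [].
  apply/setP => i; rewrite inE; have := HJ i.
  by case: (i \in J) => h; apply/esym; [exact/asboolP|exact/asboolPn].
exists [set i | `[< Q i N v >]]; split=> // i; rewrite inE.
by case: asboolP.
Qed.

Let expressible_block_ord n V (Q : forall N : structure L, (V + 'I_n -> N) -> Prop) :
  expressible Q ->
  expressible (fun N (v : V -> N) => exists d : 'I_n -> N, Q N (join v d)).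
Proof.
elim: n V Q => [|n IH] V Q HQ.
  have f0 W : 'I_0 -> W by case.
  pose h (z : V + 'I_0) : V := match z with inl x => x | inr i => f0 V i end.
  apply: expressible_ext (expressible_rename h HQ) => N v; split=> [q|[d]].
    exists (f0 N); congr (Q N _): q.
    by apply/funext => -[x|[]].
  by congr (Q N _); apply/funext => -[x|[]].
pose h (z : V + 'I_n.+1) : option V + 'I_n :=
  match z with
  | inl x => inl (Some x)
  | inr i => if unlift ord0 i is Some j then inr j else inl None
  end.
have [phi H] := IH _ _ (expressible_rename h HQ).
exists (fEx phi) => N v /=; split.
  case=> d0 /H[d q]; exists (fun i => if unlift ord0 i is Some j then d j else d0).
  congr (Q N _): q; apply/funext => -[x|i] //=.
  by case: (unlift ord0 i).
case=> d q; exists (d ord0); apply/H; exists (fun j => d (lift ord0 j)).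
congr (Q N _): q; apply/funext => -[x|i] //=.
by case: unliftP => [j ->|->].
Qed.

Lemma expressible_block (Y : finType) V (Q : forall N : structure L, (V + Y -> N) -> Prop) :
  expressible Q ->
  expressible (fun N (v : V -> N) => exists d : Y -> N, Q N (join v d)).
Proof.
move=> HQ; pose h (z : V + Y) : V + 'I_#|Y| :=
  match z with inl x => inl x | inr y => inr (enum_rank y) end.
apply: expressible_ext (expressible_block_ord (expressible_rename h HQ)) => N v.
split=> -[d q].
  exists (d \o enum_rank); congr (Q N _): q.
  by apply/funext => -[].
exists (d \o enum_val); congr (Q N _): q.
by apply/funext => -[x|y] //=; rewrite enum_rankK.
Qed.

Lemma expressible_block_forall (Y : finType) V
    (Q : forall N : structure L, (V + Y -> N) -> Prop) :
  expressible Q ->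
  expressible (fun N (v : V -> N) => forall d : Y -> N, Q N (join v d)).
Proof.
move=> HQ.
apply: expressible_ext (expressible_not (expressible_block (expressible_not HQ))) => N v.
split=> [h d|h [d /(_ (h d))]//]; apply: contrapT => nq; apply: h; exists d.
exact: nq.
Qed.

Lemma expressible_elementary V (Q : forall N : structure L, (V -> N) -> Prop)
   (N N' : structure L) (e : N -> N') (v : V -> N) :
  elementary e -> expressible Q -> Q N v <-> Q N' (fun x => e (v x)).
Proof. by move=> He [phi H]; rewrite -!H; exact: He. Qed.

End Expressible.

(** * Transfer of NIP along elementary maps *)

Section NIP.
Variable L : language.

Definition shattered (N : structure L) k m (phi : formula L ('I_k + 'I_m))
    n (a : 'I_n -> 'I_k -> N) :=
  forall I : {set 'I_n}, exists y : 'I_m -> N,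
    forall i, sat phi (join (a i) y) <-> i \in I.

Definition NIP_dim (N : structure L) k m (phi : formula L ('I_k + 'I_m)) n :=
  forall a : 'I_n -> 'I_k -> N, ~ shattered phi a.

Lemma uniformly_NIPE (N : structure L) k m (phi : formula L ('I_k + 'I_m)) :
  uniformly_NIP N phi <-> exists n, NIP_dim N phi n.
Proof.
split=> -[n H]; exists n.
  move=> a sh; apply: H; exists a => I; have [y Hy] := sh I; exists y.
  by split=> i iI; [apply/Hy|move=> /Hy; apply/negP].
case=> a sh; apply: (H a) => I; have [y [H1 H2]] := sh I; exists y => i.
by split=> [s|/H1//]; apply: contraPT s => /H2.
Qed.

(** For fixed [n] the quantifier over index sets is a finite conjunction, so non-shattering is first
    order; variables in [void] make it a sentence. *)
Lemma expressible_NIP_dim k m (phi : formula L ('I_k + 'I_m)) n :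
  expressible (fun N (v : void -> N) => NIP_dim N phi n).
Proof.
pose sh (N : structure L) (v : void + 'I_n * 'I_k -> N) :=
  forall I : {set 'I_n}, exists y : 'I_m -> N,
    forall i, sat phi (fun z => join v y match z with
      inl x => inl (inr (i, x)) | inr y => inr y end) <-> i \in I.
have Hsh : expressible sh.
  apply: expressible_forall => I.
  apply: (@expressible_block L 'I_m _ (fun N w => forall i,
     sat phi (fun z => w match z with
      inl x => inl (inr (i, x)) | inr y => inr y end) <-> i \in I)).
  apply: expressible_forall => i; case: (i \in I).
    by apply: expressible_ext (expressible_sat phi _) => N v; by split=> [s|[_ h]]; [split|exact: h].
  apply: expressible_ext (expressible_not (expressible_sat phi _)) => N v.
  by split=> [nh|[h _] /h//]; split.
apply: expressible_ext (expressible_not (expressible_block Hsh)) => N v.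
have e (a : 'I_n * 'I_k -> N) (y : 'I_m -> N) i :
  join (join v a) y \o (fun z => match z with
      inl x => inl (inr (i, x)) | inr y => inr y end) =
  join (fun x => a (i, x)) y by apply/funext => -[].
split=> [h a s|h [a s]].
  apply: h; exists (fun z => a z.1 z.2) => I; have [y Hy] := s I; exists y => i.
  by rewrite -Hy -[X in sat phi X]/(_ \o _) e.
apply: (h (fun i x => a (i, x))) => I; have [y Hy] := s I; exists y => i.
by rewrite -Hy -[X in _ <-> sat phi X]/(_ \o _) e.
Qed.

Lemma NIP_dim_elementary (N N' : structure L) (e : N -> N') k m
    (phi : formula L ('I_k + 'I_m)) n :
  elementary e -> NIP_dim N phi n <-> NIP_dim N' phi n.
Proof.
move=> He.
exact: (expressible_elementary (fun x : void => match x with end) He (expressible_NIP_dim phi n)).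
Qed.

End NIP.

Local Open Scope classical_set_scope.

Definition fFalse L V : formula L V := fNot (fEx (fEq (tvar None) (tvar None))).
Arguments fFalse {L V}.

Lemma sat_fFalse (L : language) (N : structure L) V (v : V -> N) : ~ sat fFalse v.
Proof. by move=> /= H; apply: H; exists point. Qed.

Lemma sat_fOr (L : language) (N : structure L) V (phi psi : formula L V) (v : V -> N) :
  sat (fOr phi psi) v <-> sat phi v \/ sat psi v.
Proof. by []. Qed.

Lemma sat_fNot (L : language) (N : structure L) V (phi : formula L V) (v : V -> N) :
  sat (fNot phi) v <-> ~ sat phi v.
Proof. by []. Qed.

Definition fBigOr L V (I : Type) (s : seq I) (chi : I -> formula L V) :=
  foldr (fun i p => fOr (chi i) p) fFalse s.

Lemma sat_fBigOr (L : language) (N : structure L) V (I : finType) (P : pred I)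
    (chi : I -> formula L V) (v : V -> N) :
  sat (fBigOr (enum P) chi) v <-> exists2 i, P i & sat (chi i) v.
Proof.
have aux (s : seq I) : sat (fBigOr s chi) v <-> exists2 i, i \in s & sat (chi i) v.
  elim: s => [|i s IH]; first by split=> [/sat_fFalse|[]].
  split=> [/= [h|/IH[j js h]]|[j /[!inE] /orP[/eqP -> h|js h]]].
  - by exists i; rewrite ?inE ?eqxx.
  - by exists j; rewrite ?inE ?js ?orbT.
  - by left.
  - by right; apply/IH; exists j.
rewrite aux; split=> -[i Pi h]; exists i => //; first by rewrite mem_enum in Pi.
by rewrite mem_enum.
Qed.

(** * Finitely additive measures on formulas *)

Section Content.
Variables (R : realType) (L : language) (N : structure L) (A : Type) (e : A -> N).
Variable X : Type.
Implicit Types phi psi chi : formula L (X + A).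

(** At [e := id] this is [keisler] by conversion; other [e] serve for measures known only on
    formulas over a submodel. *)
Definition content (la : formula L (X + A) -> R) : Prop :=
  [/\ forall phi psi,
        (forall a : X -> N, sat phi (join a e) <-> sat psi (join a e)) ->
        la phi = la psi,
      forall phi, 0 <= la phi,
      forall phi, (forall a : X -> N, sat phi (join a e)) -> la phi = 1 &
      forall phi psi,
        (forall a : X -> N, ~ (sat phi (join a e) /\ sat psi (join a e))) ->
        la (fOr phi psi) = la phi + la psi].

Variables (la : formula L (X + A) -> R) (cla : content la).

Lemma content_ge0 phi : 0 <= la phi. Proof. by case: cla. Qed.

Lemma content_split chi phi :
  la phi = la (fAnd phi chi) + la (fAnd phi (fNot chi)).
Proof.
have [E _ _ D] := cla; rewrite -D => [|a]; last first.
  by rewrite !sat_fAnd sat_fNot; tauto.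
apply: E => a; rewrite sat_fOr !sat_fAnd sat_fNot.
by have := EM (sat chi (join a e)); tauto.
Qed.

Lemma content_le phi psi :
  (forall a : X -> N, sat phi (join a e) -> sat psi (join a e)) -> la phi <= la psi.
Proof.
move=> h; rewrite (content_split phi psi).
have [E _ _ _] := cla.
rewrite (E (fAnd psi phi) phi) ?lerDl ?content_ge0 // => a.
by rewrite sat_fAnd; split=> [[]//|s]; split=> //; exact: h.
Qed.

Lemma content_false phi : (forall a : X -> N, ~ sat phi (join a e)) -> la phi = 0.
Proof.
have [E _ _ D] := cla => h.
have := D phi phi; rewrite (E (fOr phi phi) phi) => [H|a]; last by split=> [[]|]; [| |left].
have {}H : la phi = la phi + la phi by apply: H => a [/h].
lra.
Qed.

Lemma content_setT : la (fNot fFalse) = 1.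
Proof. by case: cla => _ _ T _; apply: T => a; exact: sat_fFalse. Qed.

Lemma content_le1 phi : la phi <= 1.
Proof. by rewrite -content_setT; apply: content_le => a _; exact: sat_fFalse. Qed.

Lemma content_fNot phi : la (fNot phi) = 1 - la phi.
Proof.
have [E _ T D] := cla.
have := D phi (fNot phi) (fun a '(conj h h') => h' h).
by rewrite T => [->|a /=]; [rewrite addrC addKr|exact: EM].
Qed.

Lemma content_fOr_le phi psi : la (fOr phi psi) <= la phi + la psi.
Proof.
have [E _ T D] := cla.
rewrite (content_split phi (fOr phi psi)).
by apply: lerD; apply: content_le => a; rewrite sat_fAnd /=; tauto.
Qed.

Lemma content_fBigOr_le (I : Type) (s : seq I) (chi : I -> formula L (X + A)) :
  la (fBigOr s chi) <= \sum_(i <- s) la (chi i).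
Proof.
elim: s => [|i s IH]; first by rewrite big_nil content_false // => a; exact: sat_fFalse.
by rewrite big_cons; apply: le_trans (content_fOr_le _ _) _; rewrite lerD2l.
Qed.

Lemma content_partition (I : finType) (P : pred I) (chi : I -> formula L (X + A)) psi :
  (forall a i j, sat (chi i) (join a e) -> sat (chi j) (join a e) -> i = j) ->
  (forall a, sat psi (join a e) <-> exists2 i, P i & sat (chi i) (join a e)) ->
  la psi = \sum_(i | P i) la (chi i).
Proof.
move=> dj hpsi; have [E _ _ D] := cla.
rewrite (E psi (fBigOr (enum P) chi)) => [|a]; last by rewrite hpsi sat_fBigOr.
rewrite -big_enum /=; have := enum_uniq P; elim: (enum P) => [_|i s IH /= /andP[is_ us]].
  by rewrite big_nil content_false // => a; exact: sat_fFalse.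
rewrite big_cons D ?IH // => a [si ss].
have : exists2 j, j \in s & sat (chi j) (join a e).
  elim: s ss {is_ us IH} => [/sat_fFalse//|j s IHs /= [h|/IHs[j' j's h]]].
    by exists j => //; rewrite inE eqxx.
  by exists j' => //; rewrite inE j's orbT.
by case=> j js /(dj _ _ _ si) ij; rewrite ij js in is_.
Qed.

End Content.

(** * Topology of type spaces *)

Section Types.
Variables (L : language) (N : structure L) (A : Type) (e : A -> N) (X : Type).
Local Notation S := (tspace e X).
Implicit Types (p q : S) (phi psi chi : formula L (X + A)).

Lemma tspace_eq p q : tset p = tset q -> p = q.
Proof. by case: p q => [p Hp] [q Hq] /= e'; subst q; congr TSpace; exact: Prop_irrelevance. Qed.

Lemma tset_realized p n (G : 'I_n -> formula L (X + A)) :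
  (forall i, tset p (G i)) -> exists a : X -> N, forall i, sat (G i) (join a e).
Proof. by have [_] := tsetP p; exact. Qed.

Lemma tset_not p phi : tset p (fNot phi) <-> ~ tset p phi.
Proof.
split=> [np pp|np]; last by case: ((tsetP p).1 phi).
have [|a Ha] := @tset_realized p 2 (fun i => if i == ord0 then phi else fNot phi).
  by move=> i; case: ifP.
by have /= := Ha ord_max; apply; exact: (Ha ord0).
Qed.

Lemma tset_le p phi psi :
  (forall a : X -> N, sat phi (join a e) -> sat psi (join a e)) -> tset p phi -> tset p psi.
Proof.
move=> h pp; apply: contrapT => /tset_not np.
have [|a Ha] := @tset_realized p 2 (fun i => if i == ord0 then phi else fNot psi).
  by move=> i; case: ifP.
by have /= := Ha ord_max; apply; apply: h; exact: (Ha ord0).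
Qed.

Lemma tset_or p phi psi : tset p (fOr phi psi) <-> tset p phi \/ tset p psi.
Proof.
split=> [po|]; last by case; apply: tset_le => a /=; [left|right].
apply: contrapT => /not_orP[/tset_not n1 /tset_not n2].
have [|a Ha] := @tset_realized p 3 (fun i => nth (fOr phi psi) [:: fNot phi; fNot psi; fOr phi psi] i).
  by move=> [[|[|[|]]]].
have [] := Ha (Ordinal (isT : (2 < 3)%N)).
  exact: (Ha (Ordinal (isT : (0 < 3)%N))).
exact: (Ha (Ordinal (isT : (1 < 3)%N))).
Qed.

Lemma tset_fFalse p : ~ tset p fFalse.
Proof.
move=> pF; have [//|a /(_ ord0)] := @tset_realized p 1 (fun=> fFalse).
exact: sat_fFalse.
Qed.

Lemma tset_fBigOr p (I : finType) (P : pred I) (chi : I -> formula L (X + A)) :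
  tset p (fBigOr (enum P) chi) <-> exists2 i, P i & tset p (chi i).
Proof.
have aux (s : seq I) : tset p (fBigOr s chi) <-> exists2 i, i \in s & tset p (chi i).
  elim: s => [|i s IH]; first by split=> [/tset_fFalse|[]].
  rewrite tset_or; split=> [[h|/IH[j js h]]|[j /[!inE] /orP[/eqP -> h|js h]]].
  - by exists i; rewrite ?inE ?eqxx.
  - by exists j; rewrite ?inE ?js ?orbT.
  - by left.
  - by right; apply/IH; exists j.
rewrite aux; split=> -[i Pi h]; exists i => //; first by rewrite mem_enum in Pi.
by rewrite mem_enum.
Qed.

Lemma clopen_ofN phi : clopen_of (fNot phi) = ~` clopen_of phi :> set S.
Proof. by apply/seteqP; split=> p /= /tset_not. Qed.

Lemma clopen_sub phi psi :
  ((clopen_of phi : set S) `<=` clopen_of psi) <->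
  forall a : X -> N, sat phi (join a e) -> sat psi (join a e).
Proof. by split=> [h a /(h (tp e a))|h p]; last exact: tset_le. Qed.

Lemma open_clopen phi : open (clopen_of phi : set S).
Proof. by move=> p pp; exists phi; split. Qed.

Lemma closed_clopen phi : closed (clopen_of phi : set S).
Proof. by rewrite -[clopen_of _]setCK -clopen_ofN; apply: open_closedC; exact: open_clopen. Qed.

Lemma nbhs_clopen p (B : set S) :
  nbhs p B <-> exists phi, tset p phi /\ clopen_of phi `<=` B.
Proof.
rewrite nbhsE; split=> [[G [oG Gp] GB]|[phi [pp pB]]].
  by have [phi [pp sG]] := oG p Gp; exists phi; split=> //; exact: subset_trans GB.
by exists (clopen_of phi) => //; split=> //; exact: open_clopen.
Qed.

(** The formulas whose clopen set belongs to a given ultrafilter form a complete type, and the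
    ultrafilter converges to it. *)
Lemma tspace_compact : compact [set: S].
Proof.
rewrite compact_ultra => F FF _.
pose p0 : set (formula L (X + A)) := [set phi | F (clopen_of phi)].
have Hp : is_type e p0.
  split=> [phi|n G HG].
    by rewrite /p0 /= clopen_ofN; exact: in_ultra_setVsetC.
  have : F [set q | forall i, tset q (G i)] by exact: filter_forall.
  by move=> /filter_ex[q Hq]; exact: (@tset_realized q).
exists (TSpace Hp); split=> // B /nbhs_clopen[phi [pp sB]].
exact: filterS pp.
Qed.

(** Compactness in the form used throughout: a property of formulas available near each type yields
    finitely many formulas covering [phi]. *)
Lemma clopen_cover phi (P : set (formula L (X + A))) :
  (forall p, tset p phi -> exists2 psi, P psi & tset p psi) ->
  exists n (psi : 'I_n -> formula L (X + A)), (forall i, P (psi i)) /\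
    forall p, tset p phi -> exists i, tset p (psi i).
Proof.
move=> cov.
have : compact (clopen_of phi : set S).
  apply: subclosed_compact tspace_compact _ => //; exact: closed_clopen.
rewrite compact_cover => co.
have /choice[g Hg] : forall p, exists psi, tset p phi -> P psi /\ tset p psi.
  move=> p; have [/cov[psi ? ?]|] := pselect (tset p phi); first by exists psi.
  by exists phi.
have [|p pp|D Dsub Dcov] := co S (clopen_of phi) (fun q => clopen_of (g q)).
- by move=> q _; exact: open_clopen.
- by exists p => //; exact: (Hg p pp).2.
pose s : seq S := enum_fset D.
exists (size s), (fun i => g (nth point s i)); split=> [i|p pp].
  have : nth point s i \in D by rewrite -[_ \in D]/(_ \in s) mem_nth.
  by move=> /Dsub /set_mem /Hg[].
have [q /= qD qp] := Dcov p pp.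
have iq : (index q s < size s)%N by rewrite index_mem.
by exists (Ordinal iq); rewrite /= nth_index.
Qed.

End Types.

Section Saturation.
Variables (K : Type) (L : language) (U : structure L).
Hypothesis satU : saturated K U.

(** [saturated] concerns subsets of [U] and variables ['I_n]; the type is transported along an
    enumeration of [X] and a section [c] of [e] over its range. *)
Lemma types_realized (A : Type) (e : A -> U) (X : finType) (p : tspace e X) :
  small K [set: A] -> exists b : X -> U, tp e b = p.
Proof.
move=> smA; pose A' := range e.
have smA' : small K A'.
  have le : (A' #<= [set: A])%card by exact: card_image_le.
  have /andP[h1 h2] := smA; apply/andP; split; first exact: card_le_trans le h1.
  by apply: contra h2 => h; exact: card_le_trans h le.
have /choice[c Hc] : forall a' : A', exists a, e a = set_val a'.
  by move=> a'; have := set_valP a'; case=> a _ ea; exists a.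
pose h (z : 'I_#|X| + A') : X + A := join (fun i => inl (enum_val i)) (fun a => inr (c a)) z.
have hE (a : X -> U) : join a e \o h = join (a \o enum_val) set_val.
  by apply/funext => -[i|a'] //=.
have Hp' : is_type (fun a : A' => set_val a : U) [set phi | tset p (rename h phi)].
  split=> [phi|n G HG]; first exact: (tsetP p).1 (rename h phi).
  have [a Ha] := @tset_realized _ _ _ _ _ p n (fun i => rename h (G i)) HG.
  by exists (a \o enum_val) => i; have := Ha i; rewrite sat_rename hE.
have [b Hb] := satU smA' (TSpace Hp').
exists (b \o enum_rank); apply: tspace_eq; apply/seteqP.
have tb phi : sat phi (join b (fun a : A' => set_val a : U)) <-> tset p (rename h phi).
  by have /(congr1 (fun q => tset q phi)) /= -> := Hb.
have key (phi : formula L (X + A)) : sat phi (join (b \o enum_rank) e) <-> tset p phi.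
  pose c' (a : A) : A' := SigSub (mem_set (ex_intro2 _ _ a I erefl : A' (e a))).
  pose g (z : X + A) : 'I_#|X| + A' :=
    join (fun x => inl (enum_rank x)) (fun a => inr (c' a)) z.
  have -> : join (b \o enum_rank) e = join b set_val \o g.
    by apply/funext => -[x|a] //=.
  rewrite -sat_rename tb rename_comp.
  (* [e] may fail to be injective, so the round trip [h \o g] can change a formula, but not its
     solutions. *)
  have st a : sat (rename (h \o g) phi) (join a e) <-> sat phi (join a e).
    rewrite sat_rename (_ : _ \o _ = join a e) //; apply/funext => -[x|a'] /=.
      by rewrite enum_rankK.
    by rewrite Hc.
  by split; apply: tset_le => a /st.
by split=> phi /= /key.
Qed.

End Saturation.

Section Levels.
Variables (R : realType) (L : language) (U M : structure L) (iM : M -> U).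
Variables (X : Type) (mu : formula L (X + U) -> R).
Hypothesis hdef : definable iM mu.

(** Around each type the continuous function [F] varies by at most [delta] on a clopen set;
    compactness leaves finitely many such sets, with [F] at their centres as levels. *)
Lemma inst_levels m (phi : formula L (X + 'I_m)) (delta : R) : 0 < delta ->
  exists n (psi : 'I_n -> formula L ('I_m + M)) (r : 'I_n -> R),
    (forall b : 'I_m -> U, exists i, sat (psi i) (join b iM)) /\
    (forall (b : 'I_m -> U) i, sat (psi i) (join b iM) -> `|mu (inst phi b) - r i| <= delta).
Proof.
move=> d0; have [F [cF HF]] := hdef.2 _ phi.
have [|n [psi [/choice[q Hq] cov]]] := @clopen_cover _ _ _ iM 'I_m (fNot fFalse)
   [set psi | exists q, forall p : tspace iM 'I_m, tset p psi -> `|F q - F p| <= delta].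
  move=> q _; have := cF q; move/cvgrPdist_le => /(_ _ d0) /nbhs_clopen[psi [qpsi Hpsi]].
  by exists psi => //; exists q.
exists n, psi, (F \o q); split=> [b|b i s].
  by have [|i si] := cov (tp iM b); [exact: sat_fFalse|exists i].
by rewrite distrC -HF; exact: Hq.
Qed.

(** Passes to the atoms generated by the overlapping levels: the atom of [b] is the set [J] of all
    levels containing it. *)
Lemma inst_partition m (phi : formula L (X + 'I_m)) (delta : R) : 0 < delta ->
  exists (I : finType) (chi : I -> formula L ('I_m + M)) (r : I -> R),
  forall b : 'I_m -> U, exists i,
    [/\ sat (chi i) (join b iM),
        forall j, sat (chi j) (join b iM) -> j = i &
        `|mu (inst phi b) - r i| <= delta].
Proof.
move=> d0; have [n [psi [r [cov Hr]]]] := inst_levels phi d0.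
have /choice[chi Hchi] : forall J : {set 'I_n}, exists chi : formula L ('I_m + M),
    forall (N : structure L) v, sat (N := N) chi v <-> J = [set i | `[< sat (psi i) v >]]%SET.
  move=> J; apply: (@expressible_pattern L 'I_n _ (fun i N v => sat (psi i) v) (fun J' => J = J')).
  by move=> i; exists (psi i).
(* The default 0 is attached to the empty atom, which no [b] meets because the levels cover. *)
exists {set 'I_n}, chi, (fun J : {set 'I_n} => if [pick i in J] is Some i then r i else 0).
move=> b; pose J := [set i | `[< sat (psi i) (join b iM) >]]%SET.
exists J; split=> [|J' /Hchi->//|]; first exact/Hchi.
have [i si] := cov b; case: pickP => [j|/(_ i)]; last by rewrite inE asboolT.
by rewrite inE => /asboolP /Hr.
Qed.

(** Regrouping [Y] with the constants of [M], and retaining finitely many of these parameters, turns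
    [psi(x, d)] into an instance of [phi]; [g] tells which entry of [d] or which constant fills each
    place. *)
Lemma separate_variables (Y : Type) (psi : formula L ((X + Y) + M)) :
  exists m (phi : formula L (X + 'I_m)) (g : 'I_m -> Y + M), forall d : Y -> U,
    inst_snd (lift_params iM psi) d = inst phi (join d iM \o g) /\
    forall a : X -> U, sat psi (join (join a d) iM) <-> sat phi (join a (join d iM \o g)).
Proof.
pose ra (z : (X + Y) + M) : X + (Y + M) :=
  match z with inl (inl x) => inl x | inl (inr y) => inr (inl y) | inr c => inr (inr c) end.
pose ra' (z : X + (Y + M)) : (X + Y) + M :=
  match z with inl x => inl (inl x) | inr (inl y) => inl (inr y) | inr (inr c) => inr c end.
have [m [g [phi Hphi]]] := parameters_finite (inr point : Y + M) (rename ra psi).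
have psiE : psi = rename ra' (inst phi g).
  by rewrite -Hphi rename_comp (_ : ra' \o ra = id) ?rename_id //; apply/funext => -[[]|].
exists m, phi, g => d; split=> [|a].
  rewrite psiE /inst_snd /lift_params /inst !rename_comp; congr rename.
  by apply/funext => -[x|i] //=; case: (g i).
rewrite psiE /inst rename_comp sat_rename.
rewrite (_ : _ \o _ = join a (join d iM \o g)) //.
by apply/funext => -[x|i] //=; case: (g i).
Qed.

Lemma separate_partition (Y : Type) m (phi : formula L (X + 'I_m)) (g : 'I_m -> Y + M)
    (delta : R) : 0 < delta ->
  exists (I : finType) (chi : I -> formula L (Y + M)) (r : I -> R),
  forall d : Y -> U, exists i,
    [/\ sat (chi i) (join d iM),
        forall j, sat (chi j) (join d iM) -> j = i &
        `|mu (inst phi (join d iM \o g)) - r i| <= delta].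
Proof.
move=> /(inst_partition phi)[I [chi [r H]]].
pose h (z : 'I_m + M) : Y + M := match z with inl i => g i | inr c => inr c end.
exists I, (fun i => rename h (chi i)), r => d.
have sh i : sat (rename h (chi i)) (join d iM) <-> sat (chi i) (join (join d iM \o g) iM).
  by rewrite sat_rename (_ : _ \o h = join (join d iM \o g) iM) //; apply/funext => -[].
have [i [h1 h2 h3]] := H (join d iM \o g); exists i; split=> //; first exact/sh.
by move=> j /sh /h2.
Qed.

End Levels.

(** * Regular Borel extension of a finitely additive measure *)

Section RegularExtension.
Variables (R : realType) (L : language) (N : structure L) (A : Type) (e : A -> N).
Variables (X : Type) (la : formula L (X + A) -> R).
Hypothesis cla : content e la.
Local Notation S := (tspace e X).
Implicit Types (B O G : set S).
Local Open Scope ereal_scope.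

(** A regular extension must take this value on an open set; [outer_content] then approximates
    arbitrary sets from outside by open ones. *)
Definition inner_content O : \bar R :=
  ereal_sup [set (la phi)%:E | phi in [set phi | (clopen_of phi : set S) `<=` O]].

Definition outer_content B : \bar R :=
  ereal_inf [set inner_content O | O in [set O : set S | open O /\ B `<=` O]].

Lemma inner_content_ge O phi :
  (clopen_of phi : set S) `<=` O -> (la phi)%:E <= inner_content O.
Proof. by move=> h; apply: ereal_sup_ubound; exists phi. Qed.

Lemma inner_content_le O x :
  (forall phi, (clopen_of phi : set S) `<=` O -> (la phi)%:E <= x) -> inner_content O <= x.
Proof. by move=> h; apply: ge_ereal_sup => _ [phi /h + <-]. Qed.

Lemma inner_content_ge0 O : 0 <= inner_content O.
Proof.
apply: le_trans (inner_content_ge (phi := fFalse) _); first by rewrite lee_fin (content_ge0 cla).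
by move=> p /tset_fFalse.
Qed.

Lemma inner_content_le1 O : inner_content O <= 1.
Proof. by apply: inner_content_le => phi _; rewrite lee_fin (content_le1 cla). Qed.

Lemma inner_content_fin O : inner_content O \is a fin_num.
Proof.
rewrite ge0_fin_numE ?inner_content_ge0 //.
by apply: le_lt_trans (inner_content_le1 O) _; rewrite ltry.
Qed.

Lemma le_inner_content O G : O `<=` G -> inner_content O <= inner_content G.
Proof. by move=> h; apply: inner_content_le => phi k; apply: inner_content_ge; exact: subset_trans h. Qed.

Lemma inner_content_clopen phi : inner_content (clopen_of phi) = (la phi)%:E.
Proof.
apply/eqP; rewrite eq_le inner_content_ge ?andbT //.
by apply: inner_content_le => psi /clopen_sub h; rewrite lee_fin (content_le cla h).
Qed.

(** A clopen set inside the union is compact, hence covered by finitely many clopen pieces, each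
    inside one [O i]; grouping them by [i] reduces to finite subadditivity. *)
Lemma inner_content_sigma (O : (set S)^nat) : (forall i, open (O i)) ->
  inner_content (\bigcup_i O i) <= \sum_(i <oo) inner_content (O i).
Proof.
move=> oO; apply: inner_content_le => phi sub.
have [p pp|n [psi [/choice[io Hio] cov]]] := @clopen_cover _ _ _ e X phi
   [set psi | exists i, (clopen_of psi : set S) `<=` O i].
  have [i _ Oip] := sub p pp; have [psi [ppsi spsi]] := oO i p Oip.
  by exists psi => //; exists i.
pose m := (\max_(j < n) io j).+1; pose Psi (i : 'I_m) := fBigOr (enum [pred j | io j == i]) psi.
have PsiO i : (clopen_of (Psi i) : set S) `<=` O i.
  by move=> p /tset_fBigOr[j /eqP <-]; exact: Hio.
have lim_ j : (io j < m)%N by rewrite ltnS (leq_bigmax j).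
have le1 : (la phi <= \sum_(i < m) la (Psi i))%R.
  apply: (@le_trans _ _ (la (fBigOr (enum 'I_m) Psi))).
    apply: (content_le cla); apply/clopen_sub => p /cov[j jp].
    apply/tset_fBigOr; exists (Ordinal (lim_ j)) => //.
    by apply/tset_fBigOr; exists j => //=.
  apply: le_trans (content_fBigOr_le cla _ _) _.
  by rewrite big_enum.
apply: (@le_trans _ _ (\sum_(0 <= i < m) inner_content (O i))).
  rewrite -lee_fin in le1; rewrite big_mkord; apply: le_trans le1 _.
  by rewrite -sumEFin; apply: lee_sum => i _; exact: inner_content_ge.
by apply: nneseries_lim_ge => i _ _; exact: inner_content_ge0.
Qed.

Lemma outer_content_open O : open O -> outer_content O = inner_content O.
Proof.
move=> oO; apply/eqP; rewrite eq_le; apply/andP; split.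
  by apply: ereal_inf_lbound; exists O => //; split.
by apply: le_ereal_inf_tmp => _ [G [oG OG] <-]; exact: le_inner_content.
Qed.

Lemma outer_content_clopen phi : outer_content (clopen_of phi) = (la phi)%:E.
Proof. by rewrite outer_content_open ?inner_content_clopen //; exact: open_clopen. Qed.

Lemma outer_content_ge0 B : 0 <= outer_content B.
Proof. by apply: le_ereal_inf_tmp => _ [G _ <-]; exact: inner_content_ge0. Qed.

Lemma le_outer_content B B' : B `<=` B' -> outer_content B <= outer_content B'.
Proof.
move=> h; apply: ereal_inf_le_tmp => _ [G [oG BG] <-]; exists G => //; split=> //.
exact: subset_trans BG.
Qed.

Lemma outer_content0 : outer_content set0 = 0.
Proof.
rewrite outer_content_open; last exact: open0.
apply/eqP; rewrite eq_le inner_content_ge0 andbT; apply: inner_content_le => phi h.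
by rewrite lee_fin (content_false cla) // => a /(h (tp e a)).
Qed.

Lemma outer_contentT : outer_content setT = 1.
Proof.
rewrite -(_ : clopen_of (fNot fFalse) = setT) ?outer_content_clopen ?(content_setT cla) //.
by rewrite clopen_ofN -subTset => p _ /tset_fFalse.
Qed.

Lemma outer_content_fin B : outer_content B \is a fin_num.
Proof.
rewrite ge0_fin_numE ?outer_content_ge0 //.
apply: le_lt_trans (le_outer_content (@subsetT _ B)) _.
by rewrite outer_contentT ltry.
Qed.

Lemma outer_content_adherent B (eps : R) : (0 < eps)%R ->
  exists O, [/\ open O, B `<=` O & inner_content O <= outer_content B + eps%:E].
Proof.
move=> e0; have [_ [V [oO BO] <-] /ltW h] := lb_ereal_inf_adherent e0 (outer_content_fin B).
by exists V; split.
Qed.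

Lemma outer_content_sigma_subadditive : sigma_subadditive outer_content.
Proof.
move=> F; apply/lee_addgt0Pr => eps e0.
have /choice[V HV] : forall i, exists O, [/\ open O, F i `<=` O &
    inner_content O <= outer_content (F i) + (eps / (2 ^ i.+1)%:R)%:E].
  by move=> i; apply: outer_content_adherent; rewrite divr_gt0 // ltr0n expn_gt0.
apply: le_trans (epsilon_trick xpredT _ (ltW e0)); last by move=> i; exact: outer_content_ge0.
apply: (@le_trans _ _ (inner_content (\bigcup_i V i))).
  apply: ereal_inf_lbound; exists (\bigcup_i V i) => //; split.
    by apply: bigcup_open => i _; have [] := HV i.
  by apply: subset_bigcup => i _; have [] := HV i.
apply: le_trans (inner_content_sigma _) _; first by move=> i; have [] := HV i.
apply: lee_nneseries => i _ //; first by rewrite inner_content_ge0.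
by have [] := HV i.
Qed.

(** Given an open [G] containing [B], take a clopen [phi] that nearly exhausts [G] within [O]. The
    rest [G'] is open and contains the part of [B] outside [O], while clopen sets inside [G'] are
    disjoint from [phi], so their values add. *)
Lemma open_caratheodory O : open O -> forall B,
  outer_content (B `&` O) + outer_content (B `&` ~` O) <= outer_content B.
Proof.
move=> oO B; apply: le_ereal_inf_tmp => _ [G [oG BG] <-].
apply/lee_addgt0Pr => eps e0.
have oGO : open (G `&` O) by exact: openI.
have [_ [phi hphi <-] /ltW lphi] := ub_ereal_sup_adherent e0 (inner_content_fin (G `&` O)).
pose G' := G `&` clopen_of (fNot phi).
have oG' : open G' by apply: openI => //; exact: open_clopen.
have h1 : outer_content (B `&` O) <= (la phi)%:E + eps%:E.
  have sBG : B `&` O `<=` G `&` O by move=> p [/BG].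
  apply: le_trans (le_outer_content sBG) _.
  by rewrite outer_content_open // -leeBlDr.
have h2 : outer_content (B `&` ~` O) <= inner_content G'.
  apply: ereal_inf_lbound; exists G' => //; split=> // p [/BG Gp nOp]; split=> //.
  by apply/tset_not => /hphi[].
have h3 : (la phi)%:E + inner_content G' <= inner_content G.
  rewrite addeC -leeBrDr //; apply: inner_content_le => psi hpsi.
  rewrite leeBrDr // -EFinD; have [_ _ _ D] := cla; rewrite -D => [|a [s1 s2]].
    apply: inner_content_ge => p /tset_or[/hpsi[]//|/hphi[]//].
  by have [_ /=] := hpsi (tp e a) s1; apply.
apply: le_trans (leeD h1 h2) _.
by rewrite addeAC leeD2r.
Qed.

Let om : {outer_measure set S -> \bar R}%R := HB.pack outer_content
  (isOuterMeasure.Build R S outer_content outer_content0 outer_content_ge0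
     le_outer_content outer_content_sigma_subadditive).

Let borel_caratheodory B : (@open S).-sigma.-measurable B -> om.-caratheodory B.
Proof.
apply: smallest_sub; first split.
- exact: caratheodory_measurable_set0.
- by move=> B' mB'; rewrite setTD; exact: caratheodory_measurable_setC.
- by move=> F mF; exact: caratheodory_measurable_bigcup.
by move=> O oO; apply: le_caratheodory_measurable; exact: open_caratheodory.
Qed.

Let nu0 : set (borel_tspace e X) -> \bar R := outer_content.

Let nu0_sigma_additive : semi_sigma_additive nu0.
Proof.
move=> F mF tF mUF.
apply: (@caratheodory_measure_sigma_additive R _ om F) => //.
- by move=> i; exact: borel_caratheodory.
- exact: borel_caratheodory.
Qed.

Let nu1 : {measure set (borel_tspace e X) -> \bar R}%R := HB.pack nu0
  (isMeasure.Build _ _ _ nu0 outer_content0 outer_content_ge0 nu0_sigma_additive).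

Let nu : probability (borel_tspace e X) R := HB.pack_for (probability (borel_tspace e X) R) (Measure.sort nu1)
  (Measure_isProbability.Build _ _ _ nu1 outer_contentT).

(** Outer regularity holds by construction. Inner regularity follows by complementation, closed sets
    being compact. *)
Theorem content_regular_probability :
  exists nu : probability (borel_tspace e X) R, regular_measure nu /\
    forall phi, nu (clopen_of (e := e) phi) = (la phi)%:E.
Proof.
exists nu; split; last exact: outer_content_clopen.
move=> B mB; split.
  congr ereal_inf; apply/seteqP; split=> x [V [oO BO] <-]; exists V => //.
    exact: outer_content_open.
  by rewrite -outer_content_open.
apply/eqP; rewrite eq_le; apply/andP; split; last first.
  by apply: ge_ereal_sup => _ [C [_ CB] <-]; exact: le_outer_content.
apply/lee_addgt0Pr => eps e0.
have [V [oO BO hO]] := outer_content_adherent (~` B) e0.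
have mO : (@open S).-sigma.-measurable V by exact: sub_sigma_algebra.
have cC : compact (~` V).
  apply: subclosed_compact (@tspace_compact _ _ _ e X) _ => //; exact: open_closedC.
apply: (@le_trans _ _ (nu (~` V) + eps%:E)).
  have hB : nu B = 1 - nu (~` B) by rewrite -probability_setC ?setCK //; exact: measurableC.
  have hC : nu (~` V) = 1 - nu V by exact: probability_setC.
  rewrite hB hC; rewrite -outer_content_open // in hO.
  have fO := outer_content_fin V; have fB := outer_content_fin (~` B).
  move: hO; rewrite -[nu V]/(outer_content V) -[nu (~` B)]/(outer_content (~` B)).
  rewrite -(fineK fO) -(fineK fB) -!EFinB -!EFinD !lee_fin; lra.
rewrite leeD2r //; apply: ereal_sup_ubound; exists (~` V) => //; split=> // p nO.
by apply: contrapT => nB; apply: nO; exact: BO.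
Qed.

End RegularExtension.

(** * Integrals of functions uniformly close to simple functions *)

Section NearSimple.
Variables (R : realType) (d : measure_display) (T : measurableType d).
Variables (P : probability T R) (I : finType) (A : I -> set T) (r : I -> R).
Variables (f : T -> R) (delta : R).
Hypotheses (mA : forall i, measurable (A i)) (mf : measurable_fun setT f).
Hypothesis near_f : forall x, exists i,
  [/\ A i x, forall j, A j x -> j = i & `|f x - r i| <= delta].

(** By [near_f] the sets [A i] form a partition and [f] is within [delta] of the simple function
    [g]. Integrability of [f] comes from that of [g] and of the bounded difference. *)
Lemma Rintegral_near_simple :
  `|\int[P]_x f x - \sum_i r i * fine (P (A i))| <= delta.
Proof.
have d0 : 0 <= delta.
  by have [i [_ _ h]] := near_f point; exact: le_trans h.
pose g x := \sum_i r i * \1_(A i) x.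
have gE x i : A i x -> (forall j, A j x -> j = i) -> g x = r i.
  move=> Ai u; rewrite /g (bigD1 i) //= indicE mem_set // mulr1 big1 ?addr0 // => j ji.
  rewrite indicE memNset ?mulr0 // => /u ij; by rewrite ij eqxx in ji.
have iind i : P.-integrable setT (EFin \o (fun x => r i * \1_(A i) x)).
  rewrite (_ : EFin \o _ = (fun x => (r i)%:E * (\1_(A i) x)%:E)%E); last first.
    by apply/funext => x /=; rewrite EFinM.
  by apply: integrableZl => //; exact: integrable_indic.
have ig s : P.-integrable setT (EFin \o (fun x => \sum_(i <- s) r i * \1_(A i) x)).
  rewrite (_ : EFin \o _ = (fun x => \sum_(i <- s) (r i * \1_(A i) x)%:E)%E); last first.
    by apply/funext => x /=; rewrite sumEFin.
  by apply: integrable_sum => // i _; exact: iind.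
have Ig s : \int[P]_x (\sum_(i <- s) r i * \1_(A i) x) = \sum_(i <- s) r i * fine (P (A i)).
  elim: s => [|i s IH].
    rewrite big_nil; under eq_Rintegral do rewrite big_nil; by rewrite Rintegral_cst ?mul0r.
  rewrite big_cons -IH; under eq_Rintegral do rewrite big_cons.
  rewrite RintegralD // RintegralZl //; last exact: integrable_indic.
  congr (_ * _ + _); rewrite /Rintegral integral_indic // setIT //.
have ifg : P.-integrable setT (EFin \o (fun x => f x - g x)).
  apply: measurable_bounded_integrable => //; first by rewrite /= probability_setT ltry.
    apply: measurable_funB => //; have /integrableP[/measurable_EFinP] := ig (index_enum I).
    by [].
  exists delta; split; first exact: num_real.
  move=> M dM x _ /=; have [i [Ai u h]] := near_f x.
  by rewrite (gE _ _ Ai u); apply: le_trans h (ltW dM).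
have if_ : P.-integrable setT (EFin \o f).
  have := integrableD measurableT ifg (ig (index_enum I)).
  by apply: eq_integrable => // x _ /=; rewrite -EFinD -/(g x) subrK.
rewrite -Ig -RintegralB //.
apply: le_trans (le_normr_Rintegral _ _) _ => //.
apply: (@le_trans _ _ (\int[P]_(x in setT) delta)).
  apply: le_Rintegral => //.
  - by have := integrable_norm ifg; apply: eq_integrable.
  - exact: finite_measure_integrable_cst.
  move=> x _; have [i [Ai u h]] := near_f x.
  by rewrite -/(g x) (gE _ _ Ai u).
have PT : fine (P setT) = 1 by rewrite probability_setT.
by rewrite Rintegral_cst // [X in _ * X]PT mulr1.
Qed.

End NearSimple.

Lemma near_clopen_measurable (R : realType) (L : language) (N : structure L) (A : Type)
    (e : A -> N) (X : Type) (f : borel_tspace e X -> R) :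
  (forall delta : R, 0 < delta -> forall q : tspace e X, exists2 chi, tset q chi &
     forall q' : tspace e X, tset q' chi -> `|f q - f q'| <= delta) ->
  measurable_fun setT f.
Proof.
move=> H mD; apply: (measurability _ (RGenOInfty.measurableE R)) => //.
move=> _ [_ [x ->] <-]; rewrite setTI.
suff o : open (f @^-1` `]x, +oo[%classic : set (tspace e X)) by exact: sub_sigma_algebra.
rewrite openE => q /=; rewrite in_itv /= andbT => xf.
have d0 : 0 < (f q - x) / 2 by rewrite divr_gt0 // subr_gt0.
have [chi qchi Hchi] := H _ d0 q; apply/nbhs_clopen; exists chi; split=> // q' /Hchi.
rewrite /= in_itv /= andbT ler_norml => /andP[_]; lra.
Qed.

(** * Uniform approximation by finite averages *)

Definition ind (R : realType) (P : Prop) : R := (`[< P >])%:R.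

Lemma ind_ge0 (R : realType) P : 0 <= ind R P. Proof. exact: ler0n. Qed.

Lemma ind_le1 (R : realType) P : ind R P <= 1.
Proof. by rewrite /ind; case: `[< P >]. Qed.

Lemma ind_true (R : realType) (P : Prop) : P -> ind R P = 1.
Proof. by move=> p; rewrite /ind asboolT. Qed.

Lemma ind_false (R : realType) (P : Prop) : ~ P -> ind R P = 0.
Proof. by move=> p; rewrite /ind asboolF. Qed.

Lemma ind_iff (R : realType) (P Q : Prop) : (P <-> Q) -> ind R P = ind R Q.
Proof. by move=> h; rewrite /ind (asbool_equiv_eq h). Qed.

Lemma ind_not (R : realType) (P : Prop) : ind R (~ P) = 1 - ind R P.
Proof.
have [p|np] := pselect P; first by rewrite (ind_true _ p) ind_false ?subrr //; exact.
by rewrite (ind_false _ np) ind_true ?subr0.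
Qed.

Section Averages.
Variables (R : realType) (L : language) (U : structure L).

Lemma AvE n X Y (a : 'I_n -> X -> U) (phi : formula L (X + Y)) (b : Y -> U) :
  Av R a phi b = (\sum_i ind R (sat phi (join (a i) b))) / n%:R.
Proof.
rewrite /Av -sum1_card natr_sum big_mkcond /=; congr (_ / _).
by apply: eq_bigr => i _; rewrite /ind inE; case: `[< _ >].
Qed.

Lemma Av_le1 n X Y (a : 'I_n -> X -> U) (phi : formula L (X + Y)) (b : Y -> U) :
  Av R a phi b <= 1.
Proof.
case: n a => [|n] a; first by rewrite AvE big_ord0 mul0r.
rewrite AvE ler_pdivrMr ?ltr0n // mul1r -[n.+1 in leRHS]card_ord -sum1_card natr_sum.
by apply: ler_sum => i _; exact: ind_le1.
Qed.

Lemma Av_fNot n X Y (a : 'I_n.+1 -> X -> U) (phi : formula L (X + Y)) (b : Y -> U) :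
  Av R a (fNot phi) b = 1 - Av R a phi b.
Proof.
rewrite !AvE; under eq_bigr do rewrite [sat _ _]/(~ _) ind_not.
by rewrite sumrB sumr_const card_ord mulrBl divff // pnatr_eq0.
Qed.

(** The law is applied to the system of traces on [Om] of the sets [phi(x, b)]; a tuple shattered by
    it maps under [c] to one shattered by [phi]. The sample size does not depend on [Om], [c] or
    [p]. *)
Lemma NIP_uniform_law k m (phi : formula L ('I_k + 'I_m)) (eps eta : R) :
  (exists d, NIP_dim U phi d) -> 0 < eps -> 0 < eta ->
  exists n, forall (Om : finType) (c : Om -> 'I_k -> U) (p : Om -> R),
  (forall a, 0 <= p a) -> \sum_a p a = 1 ->
  \sum_(x : {ffun 'I_n.+1 -> Om}) pweight p x *
    ind R (exists b, eps <= `|Av R (fun i => c (x i)) phi b -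
                             \sum_a p a * ind R (sat phi (join (c a) b))|) <= eta.
Proof.
move=> [d Hd] e0 eta0; have [n Hn] := vc_uniform_law d e0 eta0; exists n => Om c p p0 p1.
pose fib (b : 'I_m -> U) : {set Om} := [set a | `[< sat phi (join (c a) b) >]]%SET.
pose CC : {set {set Om}} := [set C | `[< exists b, C = fib b >]]%SET.
apply: le_trans (Hn Om p CC p0 p1 _); last first.
  move=> y sh; apply: (Hd (c \o y)) => I; have [C] := sh I.
  rewrite inE => /asboolP[b ->] H; exists b => i.
  by rewrite -H inE; split=> [/asboolT|/asboolP].
rewrite [leRHS]big_mkcond; apply: ler_sum => x _.
have [[b Hb]|nb] := pselect (exists b, eps <= `|Av R (fun i => c (x i)) phi b -
                             \sum_a p a * ind R (sat phi (join (c a) b))|); last first.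
  by rewrite ind_false // mulr0; case: ifP => // _; exact: pweight_ge0.
rewrite ind_true ?mulr1; last by exists b.
rewrite ifT //; apply/existsP; exists (fib b); apply/andP; split.
  by rewrite inE; apply/asboolP; exists b.
congr (_ <= `| _ - _ |): Hb.
  rewrite AvE hitsE; congr (_ / _); apply: eq_bigr => i _.
  by rewrite inE.
rewrite /mass [RHS]big_mkcond; apply: eq_bigr => a _; rewrite inE /ind.
by case: `[< _ >]; rewrite ?mulr1 ?mulr0.
Qed.

End Averages.

(* Blackwell approachability: the potential [\sum_a (s_a)^+ ^ 2] of the
   deficits [s_a] grows linearly in time when the response to the weights
   [(s_a)^+] has nonpositive mean deficit, so that each [s_a] is o(t). *)
Section Approachability.
Variables (R : realType) (I : finType) (B : Type) (b0 : B) (g : I -> B -> R) (eps : R).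
Hypotheses (e0 : 0 < eps) (g1 : forall a b, `|g a b| <= 1).
Hypothesis resp : forall p : I -> R, (forall a, 0 <= p a) -> \sum_a p a = 1 ->
  exists b, eps <= \sum_a p a * g a b.

Lemma response (w : I -> R) : (forall a, 0 <= w a) ->
  exists b, \sum_a w a * (eps - g a b) <= 0.
Proof.
move=> w0; set W := \sum_a w a.
have [W0|W0] := eqVneq W 0.
  exists b0; rewrite big1 // => a _.
  by rewrite (psumr_eq0P (fun a _ => w0 a) W0) ?mul0r.
have Wp : 0 < W by rewrite lt_def W0 sumr_ge0.
have [|b Hb] := resp (p := fun a => w a / W) (fun a => divr_ge0 (w0 a) (ltW Wp)).
  by rewrite -mulr_suml divff.
exists b; under eq_bigr do rewrite mulrBr.
rewrite sumrB -mulr_suml -/W subr_le0 mulrC -ler_pdivlMr // mulr_suml.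
by apply: le_trans Hb _; apply: ler_sum => a _; rewrite mulrAC.
Qed.

Theorem approachability : exists T (b : 'I_T.+1 -> B), forall a,
  T.+1%:R * (eps / 2) <= \sum_t g a (b t).
Proof.
pose pos (x : R) := Num.max 0 x.
have pos0 x : 0 <= pos x by rewrite /pos le_max lexx.
have /choice[f Hf] : forall s : I -> R, exists b, \sum_a pos (s a) * (eps - g a b) <= 0.
  by move=> s; apply: response => a; exact: pos0.
(* [st t a] is the deficit of [a] after [t] rounds, each round playing the response to the positive
   parts of the current deficits. *)
pose st := fix st (t : nat) : I -> R :=
  if t is t'.+1 then fun a => st t' a + (eps - g a (f (st t'))) else fun=> 0.
pose Cst := (eps + 1) ^+ 2.
have step x y : `|y| <= eps + 1 -> pos (x + y) ^+ 2 <= pos x ^+ 2 + 2 * (pos x * y) + Cst.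
  move=> hy; have y2 : y ^+ 2 <= Cst.
    by rewrite -[y ^+ 2]ger0_norm ?sqr_ge0 // normrX lerXn2r ?nnegrE // addr_ge0 // ltW.
  have C0 : 0 <= Cst by exact: sqr_ge0.
  by rewrite /pos; case: (leP 0 x) => hx; case: (leP 0 (x + y)) => hxy; nra.
have pot t : \sum_a pos (st t a) ^+ 2 <= t%:R * (#|I|%:R * Cst).
  elim: t => [|t IH].
    by rewrite mul0r big1 // => a _; rewrite /pos /= maxxx expr0n.
  apply: (@le_trans _ _ (\sum_a (pos (st t a) ^+ 2 +
      2 * (pos (st t a) * (eps - g a (f (st t)))) + Cst))).
    apply: ler_sum => a _; apply: step; apply: le_trans (ler_normB _ _) _.
    by rewrite (gtr0_norm e0) lerD2l.
  rewrite !big_split /= -mulr_sumr sumr_const -[Cst *+ _]mulr_natl -natr1.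
  by have := Hf (st t); move: IH; lra.
have stE t a : st t a = t%:R * eps - \sum_(i < t) g a (f (st i)).
  elim: t => [|t IH] /=; first by rewrite big_ord0 mul0r subrr.
  by rewrite IH big_ord_recr /= -natr1; ring.
(* Once [T.+1 >= q], the linear bound on the potential is at most [(T.+1 (eps / 2))^2], so every
   deficit is at most half of [T.+1 eps]. *)
pose q := #|I|%:R * Cst / (eps / 2) ^+ 2.
pose T := Num.truncn q; exists T, (fun t => f (st t)) => a.
have qT : q <= T.+1%:R by apply: ltW; exact: truncnS_gt.
have T0 : 0 < T.+1%:R :> R by rewrite ltr0n.
have e2 : 0 < (eps / 2) ^+ 2 by rewrite exprn_gt0 // divr_gt0.
have h : pos (st T.+1 a) ^+ 2 <= (T.+1%:R * (eps / 2)) ^+ 2.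
  apply: (@le_trans _ _ (\sum_a pos (st T.+1 a) ^+ 2)).
    by rewrite (bigD1 a) //= lerDl sumr_ge0 // => i _; exact: sqr_ge0.
  apply: le_trans (pot _) _; rewrite exprMn [X in _ <= X * _]expr2 -mulrA ler_wpM2l ?(ltW T0) //.
  by rewrite -ler_pdivrMr.
have {}h : pos (st T.+1 a) <= T.+1%:R * (eps / 2).
  by move: h; rewrite ler_sqr ?nnegrE // mulr_ge0 ?(ltW T0) // divr_ge0 // ltW.
have : st T.+1 a <= pos (st T.+1 a) by rewrite /pos le_max lexx orbT.
by move/le_trans/(_ h); rewrite stE; lra.
Qed.

End Approachability.

(** * Approximation of [mu] from above by averages over points of [M] *)

Section FiniteApproximation.
Variables (R : realType) (K : Type) (L : language) (U M : structure L) (iM : M -> U).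
Hypotheses (satU : saturated K U) (smM : small K [set: M]).
Variables (k : nat) (mu : formula L ('I_k + U) -> R).
Hypotheses (hmu : keisler mu) (hdef : definable iM mu) (hfs : finitely_satisfiable iM mu).
Hypothesis NIP : forall p q (phi : formula L ('I_p + 'I_q)), exists n, NIP_dim U phi n.

Let cmu : content id mu := hmu.

Definition inM (a : 'I_k -> M) : 'I_k -> U := fun x => iM (a x).

Lemma sat_inst m (phi : formula L ('I_k + 'I_m)) (b : 'I_m -> U) (a : 'I_k -> U) :
  sat (inst phi b) (join a id) <-> sat phi (join a b).
Proof. by rewrite sat_rename (_ : _ \o _ = join a b) //; apply/funext => -[]. Qed.

(** The right-hand side is the [mu]-mean of the number of [t] with [phi(x, b t)]. Some atom of
    positive measure has at most that many, and finite satisfiability realizes it in [M]. *)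
Lemma fs_average n m (phi : formula L ('I_k + 'I_m)) (b : 'I_n -> 'I_m -> U) :
  exists a : 'I_k -> M,
    \sum_t ind R (sat phi (join (inM a) (b t))) <= \sum_t mu (inst phi (b t)).
Proof.
have /choice[chi Hchi] : forall J : {set 'I_n}, exists chi : formula L ('I_k + U),
    forall (N : structure L) v, sat (N := N) chi v <->
      J = [set t | `[< sat (inst phi (b t)) v >]]%SET.
  move=> J; apply: (@expressible_pattern L 'I_n _
    (fun t N v => sat (inst phi (b t)) v) (fun J' => J = J')).
  by move=> t; exists (inst phi (b t)).
have dj a i j : sat (chi i) (join a (id : U -> U)) -> sat (chi j) (join a id) -> i = j.
  by move=> /Hchi -> /Hchi ->.
have tot : \sum_J mu (chi J) = 1.
  rewrite -(content_setT cmu); symmetry; apply: (content_partition cmu dj) => a.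
  split=> _; last exact: sat_fFalse.
  by exists [set t | `[< sat (inst phi (b t)) (join a id) >]]%SET => //; apply/Hchi.
have Ft t : mu (inst phi (b t)) = \sum_(J : {set 'I_n} | t \in J) mu (chi J).
  apply: (content_partition cmu dj) => a; split=> [s|[J tJ /Hchi JE]].
    exists [set t | `[< sat (inst phi (b t)) (join a id) >]]%SET; last exact/Hchi.
    by rewrite inE; apply/asboolP.
  by move: tJ; rewrite JE inE => /asboolP.
set s := \sum_t mu _.
have sE : s = \sum_J mu (chi J) * #|J|%:R.
  rewrite /s; under eq_bigr do rewrite Ft big_mkcond.
  rewrite exchange_big /=; apply: eq_bigr => J _.
  by rewrite -big_mkcond sumr_const mulr_natr.
have [J muJ Js] : exists2 J, 0 < mu (chi J) & #|J|%:R <= s.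
  apply: contrapT => nJ.
  have pos J : 0 < mu (chi J) -> s < #|J|%:R.
    by move=> muJ; rewrite ltNge; apply/negP => Js; apply: nJ; exists J.
  have z : \sum_J mu (chi J) * (#|J|%:R - s) = 0.
    by under eq_bigr do rewrite mulrBr; rewrite sumrB -sE -mulr_suml tot mul1r subrr.
  have nn J : 0 <= mu (chi J) * (#|J|%:R - s).
    have := content_ge0 cmu (chi J); rewrite le_eqVlt => /orP[/eqP <-|h]; first by rewrite mul0r.
    by rewrite mulr_ge0 ?(ltW h) // subr_ge0 ltW // pos.
  suff : \sum_J mu (chi J) = 0 by rewrite tot => /eqP; rewrite oner_eq0.
  apply: big1 => J _; apply/eqP; rewrite eq_le (content_ge0 cmu) andbT leNgt; apply/negP => h.
  have := psumr_eq0P (fun J _ => nn J) z (i := J) erefl.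
  by apply/eqP; rewrite mulf_neq0 ?gt_eqF // subr_gt0 pos.
have [a Ha] := hfs muJ; exists a; apply: le_trans Js.
move/Hchi: Ha => JE; rewrite -sum1_card natr_sum [leRHS]big_mkcond; apply: ler_sum => t _.
rewrite [in leRHS]JE inE /inM (ind_iff R (iff_sym (sat_inst phi (b t) _))) /ind.
by case: `[< _ >].
Qed.

Section OneSided.
Variables (m : nat) (phi : formula L ('I_k + 'I_m)) (eps : R).
Hypothesis e0 : 0 < eps.
Hypothesis fail : forall N (a : 'I_N.+1 -> 'I_k -> M), exists b,
  mu (inst phi b) + eps < Av R (fun i => inM (a i)) phi b.

(** A sample drawn with weights [p] is a genuine tuple, to which [fail] applies; replacing its
    average by the weighted one costs [eps / 2]. *)
Lemma fail_weights s (c : 'I_s -> 'I_k -> M) (p : 'I_s -> R) :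
  (forall a, 0 <= p a) -> \sum_a p a = 1 ->
  exists b, eps / 2 <= \sum_a p a * (ind R (sat phi (join (inM (c a)) b)) - mu (inst phi b)).
Proof.
move=> p0 p1; have e2 : 0 < eps / 2 by rewrite divr_gt0.
have h2 : 0 < 1 / 2 :> R by rewrite divr_gt0.
have [n Hn] := NIP_uniform_law (NIP phi) e2 h2.
pose bad (x : {ffun 'I_n.+1 -> 'I_s}) := exists b,
  eps / 2 <= `|Av R (fun i => inM (c (x i))) phi b -
       \sum_a p a * ind R (sat phi (join (inM (c a)) b))|.
have le12 : \sum_x pweight p x * ind R (bad x) <= 1 / 2 := Hn 'I_s (fun a => inM (c a)) p p0 p1.
have [x nx] : exists x, ~ bad x.
  apply: contrapT => nx; move: le12.
  under eq_bigr => x _.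
    rewrite (_ : ind R _ = 1) ?mulr1; first over.
    by apply: ind_true; apply: contrapT => h; apply: nx; exists x.
  by rewrite sum_pweight //; lra.
have [b Hb] := fail (fun i => c (x i)); exists b.
under eq_bigr do rewrite mulrBr; rewrite sumrB -mulr_suml p1 mul1r.
have : ~ (eps / 2 <= `|Av R (fun i => inM (c (x i))) phi b -
       \sum_a p a * ind R (sat phi (join (inM (c a)) b))|) by move=> h; apply: nx; exists b.
by move=> /negP; rewrite -ltNge ltr_norml => /andP[_]; move: Hb; lra.
Qed.

Lemma mu_inst_bounds (b : 'I_m -> U) : 0 <= mu (inst phi b) <= 1.
Proof. by rewrite (content_ge0 cmu) (content_le1 cmu). Qed.

(** Approachability gives a number of responses depending on [c]. Resampling among them with the law
    for the dual formula brings the number down to [n.+1], chosen before [s] and [c]. *)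
Lemma fail_finite : exists n, forall s (c : 'I_s -> 'I_k -> M),
  exists b : 'I_n.+1 -> 'I_m -> U, forall a, n.+1%:R * (eps / 8) <=
    \sum_t (ind R (sat phi (join (inM (c a)) (b t))) - mu (inst phi (b t))).
Proof.
(* Approachability leaves a mean gain of [eps / 4], and resampling costs [h] for [phi] and [h] for
   [mu]. By Markov, [mu] rises by [h] with probability at most [1 / (1 + h)], which is [1 - 2 eta],
   so a sample avoiding this and the bad event exists. *)
pose h := eps / 16; have h0 : 0 < h by rewrite divr_gt0.
pose eta := h / (1 + h) / 2.
have h1 : 0 < 1 + h by rewrite addr_gt0.
have eta0 : 0 < eta by rewrite !divr_gt0.
pose sw (z : 'I_k + 'I_m) : 'I_m + 'I_k := match z with inl x => inr x | inr y => inl y end.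
have [n Hn] := NIP_uniform_law (NIP (rename sw phi)) h0 eta0; exists n => s c.
have [] := @approachability R 'I_s ('I_m -> U) (fun=> point)
  (fun a b => ind R (sat phi (join (inM (c a)) b)) - mu (inst phi b)) (eps / 2).
- by rewrite divr_gt0.
- move=> a b; have := mu_inst_bounds b; have := ind_ge0 R (sat phi (join (inM (c a)) b)).
  by have := ind_le1 R (sat phi (join (inM (c a)) b)); rewrite ler_norml; lra.
- exact: fail_weights.
move=> T [b Hb]; have T0 : 0 < T.+1%:R :> R by rewrite ltr0n.
pose p (t : 'I_T.+1) : R := T.+1%:R^-1.
have p0 t : 0 <= p t by rewrite invr_ge0 ltW.
have p1 : \sum_t p t = 1 by rewrite sumr_const card_ord -[_ *+ _]mulr_natr mulVf // gt_eqF.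
pose bad (x : {ffun 'I_n.+1 -> 'I_T.+1}) := exists a : 'I_k -> U,
  h <= `|Av R (fun i => b (x i)) (rename sw phi) a -
       \sum_t p t * ind R (sat (rename sw phi) (join (b t) a))|.
have Hbad : \sum_x pweight p x * ind R (bad x) <= eta := Hn 'I_T.+1 b p p0 p1.
pose F t := mu (inst phi (b t)); pose avF := \sum_t p t * F t.
have n0 : 0 < n.+1%:R :> R by rewrite ltr0n.
have avF0 : 0 <= avF <= 1.
  rewrite sumr_ge0 => [|t _]; last by rewrite mulr_ge0 //; case/andP: (mu_inst_bounds (b t)).
  rewrite -p1; apply: ler_sum => t _; rewrite ler_piMr //.
  by case/andP: (mu_inst_bounds (b t)).
have [x [nx Fx]] : exists x : {ffun 'I_n.+1 -> 'I_T.+1},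
    ~ bad x /\ \sum_i F (x i) < n.+1%:R * (avF + h).
  apply: contrapT => no.
  have Mk := @markov_pweight R 'I_T.+1 p p0 n.+1 (fun x => \sum_i F (x i)) (n.+1%:R * (avF + h)).
  have c0 : 0 < n.+1%:R * (avF + h) by rewrite mulr_gt0 // ltr_wpDl //; case/andP: avF0.
  have := Mk c0 (fun x => sumr_ge0 _ (fun i _ => (andP (mu_inst_bounds _)).1)).
  rewrite expect_sum_coord // -/avF -mulf_div divff ?gt_eqF // mul1r.
  apply/negP; rewrite -ltNge.
  have e1 : avF / (avF + h) <= 1 - 2 * eta.
    rewrite ler_pdivrMr; last by rewrite ltr_wpDl //; case/andP: avF0.
    have -> : 1 - 2 * eta = (1 + h)^-1 by rewrite /eta; field; rewrite gt_eqF.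
    by rewrite ler_pdivlMl //; case/andP: avF0; nra.
  apply: le_lt_trans e1 _; apply: (@lt_le_trans _ _ (1 - eta)); first lra.
  have := @sum_pweight R 'I_T.+1 p p1 n.+1 => tot.
  rewrite lerBlDr -[leLHS]tot.
  apply: (@le_trans _ _ (\sum_(x : {ffun 'I_n.+1 -> 'I_T.+1} | n.+1%:R * (avF + h) <= \sum_i F (x i)) pweight p x +
     \sum_(x : {ffun 'I_n.+1 -> 'I_T.+1}) pweight p x * ind R (bad x))); last by rewrite lerD2l.
  rewrite [X in _ <= X + _]big_mkcond -big_split /=; apply: ler_sum => x _.
  have w0 := pweight_ge0 p0 x; have i0 := ind_ge0 R (bad x).
  case: ifP => [_|/negbT]; first by rewrite lerDl mulr_ge0.
  rewrite -ltNge => lt; rewrite add0r ind_true ?mulr1 //.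
  by apply: contrapT => nb; apply: no; exists x.
exists (fun i => b (x i)) => a.
have satsw t : sat (rename sw phi) (join (b t) (inM (c a))) <-> sat phi (join (inM (c a)) (b t)).
  by rewrite sat_rename (_ : _ \o sw = join (inM (c a)) (b t)) //; apply/funext => -[].
have dev : `|Av R (fun i => b (x i)) (rename sw phi) (inM (c a)) -
       \sum_t p t * ind R (sat (rename sw phi) (join (b t) (inM (c a))))| < h.
  by rewrite ltNge; apply/negP => hb; apply: nx; exists (inM (c a)).
move: dev; rewrite AvE ltr_norml => /andP[+ _].
under eq_bigr do rewrite (ind_iff R (satsw _)).
under [X in _ - X]eq_bigr do rewrite (ind_iff R (satsw _)).
move: Fx (Hb a); rewrite /avF /p -!mulr_sumr !sumrB.
set S1 := \sum_t F t; set S2 := \sum_(i < T.+1) ind R _; set S3 := \sum_i F (x i).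
set S4 := \sum_(i < n.+1) ind R _; rewrite -/S1 -/S3.
set u := T.+1%:R^-1 * S2; set v := T.+1%:R^-1 * S1 => hS3 hS2.
have uv : eps / 4 <= u - v.
  by rewrite -mulrBr ler_pdivlMl //; move: hS2; lra.
move=> /ltW hS4.
have : n.+1%:R * (u - h) <= S4.
  by rewrite -ler_pdivlMl // [leRHS]mulrC; move: hS4; move: (S4 / _) => z; lra.
have : 0 <= n.+1%:R * (u - v - eps / 4) by rewrite mulr_ge0 ?(ltW n0) // subr_ge0.
move: hS3; rewrite /h; lra.
Qed.

(** For each type of a tuple of blocks, [fs_average] gives a point of [M] with total gain at most 0,
    and some formula of the type keeps that gain below the bound of [fail_finite]. By compactness
    finitely many points serve all tuples, against [fail_finite] for these points. *)
Lemma one_sided_contradiction : False.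
Proof.
have [n Hn] := fail_finite; pose Y := ('I_n.+1 * 'I_m)%type.
have n0 : 0 < n.+1%:R :> R by rewrite ltr0n.
(* Two values of [mu] on the same level then differ by at most [eps / 16], less than the allowed
   [eps / 8]. *)
have d0 : 0 < eps / 32 by rewrite divr_gt0.
have [J [psi [r [cov Hr]]]] := inst_levels hdef phi d0.
pose blk (y : Y -> U) (t : 'I_n.+1) : 'I_m -> U := fun i => y (t, i).
pose P : set (formula L (Y + M)) := [set chi | exists a : 'I_k -> M, forall y,
  sat chi (join y iM) -> \sum_t (ind R (sat phi (join (inM a) (blk y t))) -
     mu (inst phi (blk y t))) < n.+1%:R * (eps / 8)].
have [q _|s [chi [/choice[c Hc] Hcov]]] := @clopen_cover _ _ _ iM Y (fNot fFalse) P.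
  have [y <-] := types_realized satU q smM.
  have [a Ha] := fs_average phi (blk y).
  have /choice[jt Hjt] := fun t => cov (blk y t).
  pose h t (z : 'I_m + M) : Y + M := match z with inl i => inl (t, i) | inr c => inr c end.
  pose g t (z : 'I_k + 'I_m) : Y + M := match z with inl i => inr (a i) | inr i => inl (t, i) end.
  (* The formula fixes a level for each block and the truth value of [phi] at [a]; it is over [M]
     because [a] is. *)
  have [chi Hchi] : expressible (fun (N : structure L) (v : Y + M -> N) => forall t,
      sat (psi (jt t)) (fun z => v (h t z)) /\
      (sat phi (fun z => v (g t z)) <-> sat phi (join (inM a) (blk y t)))).
    apply: expressible_forall => t; apply: expressible_and; first exact: expressible_sat.
    have [s|ns] := pselect (sat phi (join (inM a) (blk y t))).
      apply: expressible_ext (expressible_sat phi (g t)) => N v.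
      by split=> [h'|[_ /(_ s)]//]; split.
    apply: expressible_ext (expressible_not (expressible_sat phi (g t))) => N v.
    by split=> [h'|[h' _] /h'//]; split=> // /h'.
  have hE t y' : (fun z => join y' iM (h t z)) = join (blk y' t) iM.
    by apply/funext => -[].
  have gE t y' : (fun z => join y' iM (g t z)) = join (inM a) (blk y' t).
    by apply/funext => -[].
  exists chi; last first.
    by apply/Hchi => t; rewrite hE gE; split.
  exists a => y' /Hchi Hy'.
  have : \sum_t (ind R (sat phi (join (inM a) (blk y' t))) - mu (inst phi (blk y' t))) <=
         \sum_t (ind R (sat phi (join (inM a) (blk y t))) - mu (inst phi (blk y t)) + eps / 16).
    apply: ler_sum => t _; have := Hy' t; rewrite hE gE => -[/Hr h1 /(ind_iff R) ->].
    have h2 := Hr _ _ (Hjt t); move: h1 h2; rewrite !ler_norml => /andP[? ?] /andP[? ?]; lra.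
  move/le_lt_trans; apply; rewrite !big_split /= sumrN sumr_const card_ord -[_ *+ _]mulr_natl.
  have : 0 < n.+1%:R * eps by rewrite mulr_gt0.
  move: Ha; lra.
have [b Hb] := Hn s c.
have [|i Hi] := Hcov (tp iM (fun z : Y => b z.1 z.2)); first exact: sat_fFalse.
have := Hc i _ Hi; have := Hb i; rewrite /blk /= => h1 h2.
by have := le_lt_trans h1 h2; rewrite ltxx.
Qed.

End OneSided.

Theorem finite_approximation m (phi : formula L ('I_k + 'I_m)) (eps : R) : 0 < eps ->
  exists N (a : 'I_N.+1 -> 'I_k -> M), forall b,
    Av R (fun i => inM (a i)) phi b <= mu (inst phi b) + eps.
Proof.
move=> e0; apply: contrapT => no; apply: (one_sided_contradiction e0 (phi := phi)) => N a.
apply: contrapT => nb; apply: no; exists N, a => b; rewrite leNgt; apply/negP => lt.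
by apply: nb; exists b.
Qed.

End FiniteApproximation.

(** * Morley powers *)

Section MorleyProduct.
Variables (R : realType) (K : Type) (L : language) (U M : structure L) (iM : M -> U).
Hypotheses (satU : saturated K U) (elM : elementary iM) (smM : small K [set: M]).
Variables (X : Type) (mu : formula L (X + U) -> R).
Hypothesis hdef : definable iM mu.
Variables (Y : finType) (la : formula L (Y + U) -> R).
Hypothesis cla : content iM (fun chi => la (lift_params iM chi)).

Lemma sat_lift_params (N : structure L) Z (c : M -> N) (iN : N -> U)
    (chi : formula L (Z + M)) (d : Z -> U) : (forall x, iN (c x) = iM x) ->
  sat (lift_params c chi) (join d iN) <-> sat chi (join d iM).
Proof.
move=> cE; rewrite sat_rename (_ : _ \o _ = join d iM) //.
by apply/funext => -[z|x] //=; rewrite cE.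
Qed.

Lemma lift_params_comp (N : structure L) Z (c : M -> N) (iN : N -> U)
    (chi : formula L (Z + M)) : (forall x, iN (c x) = iM x) ->
  lift_params iN (lift_params c chi) = lift_params iM chi.
Proof.
move=> cE; rewrite /lift_params rename_comp; congr rename.
by apply/funext => -[z|x] //=; rewrite cE.
Qed.

Variables (psi : formula L ((X + Y) + M)).
Variables (m : nat) (phi : formula L (X + 'I_m)) (g : 'I_m -> Y + M).
Hypothesis sep : forall d : Y -> U, inst_snd (lift_params iM psi) d = inst phi (join d iM \o g).

Lemma mu_inst_tp (d d' : Y -> U) : tp iM d = tp iM d' ->
  mu (inst_snd (lift_params iM psi) d) = mu (inst_snd (lift_params iM psi) d').
Proof.
move=> tpE; rewrite !sep; apply: hdef.1.
pose h (z : 'I_m + M) : Y + M := match z with inl i => g i | inr c => inr c end.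
have hE (d0 : Y -> U) : join d0 iM \o h = join (join d0 iM \o g) iM.
  by apply/funext => -[].
apply: tspace_eq; apply/seteqP; suff H : forall chi,
   sat chi (join (join d iM \o g) iM) <-> sat chi (join (join d' iM \o g) iM).
  by split=> chi /= /H.
move=> chi; rewrite -!hE -!sat_rename.
by have /(congr1 (fun q => tset q (rename h chi))) /= -> := tpE.
Qed.

(** The base model can be [M] itself: [la] is known to be additive only on formulas over [M], and
    this already provides the regular Borel measure. *)
Lemma morley_value_exists : exists r, morley_value K iM mu la (lift_params iM psi) r.
Proof.
have [nu [rnu nuE]] := content_regular_probability cla.
have /choice[rl Hrl] := fun q : tspace iM Y => types_realized satU q smM.
pose f q := mu (inst_snd (lift_params iM psi) (rl q)).
exists (\int[nu]_q f q), M, iM; split; first by split=> //; exists psi.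
exists nu, f; split=> // d; apply: mu_inst_tp; exact: Hrl.
Qed.

(** [get] may select a value computed over any small [N] above [M]. The estimate holds for each of
    them, since the partition is over [M] and lifts to [N]. *)
Lemma morley_product_near (I : finType) (chi : I -> formula L (Y + M)) (r : I -> R) delta :
  (forall d : Y -> U, exists i,
    [/\ sat (chi i) (join d iM),
        forall j, sat (chi j) (join d iM) -> j = i &
        `|mu (inst phi (join d iM \o g)) - r i| <= delta]) ->
  `|morley_product K iM mu la (lift_params iM psi) -
    \sum_i r i * la (lift_params iM (chi i))| <= delta.
Proof.
move=> Hchi; rewrite /morley_product.
have := getPex morley_value_exists; set v := get _.
case=> N [iN [[elN smN rg _] [nu [f [[rnu nuE] fE ->]]]]].
have /choice[c Hc] : forall x, exists y, iN y = iM x.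
  by move=> x; have [|y _ yx] := rg (iM x); [exists x|exists y].
have mclop (ch : formula L (Y + N)) :
    @measurable _ (borel_tspace iN Y) (clopen_of (e := iN) ch).
  apply: sub_sigma_algebra; exact: open_clopen.
have tch (ch : formula L (Y + M)) (d : Y -> U) :
   tset (tp iN d) (lift_params c ch) <-> sat ch (join d iM) := sat_lift_params ch d Hc.
have mf : measurable_fun setT (f : borel_tspace iN Y -> R).
  apply: near_clopen_measurable => eps e0 q.
  have e2 : 0 < eps / 2 by rewrite divr_gt0.
  have [J [ch [s Hs]]] := separate_partition hdef phi g e2.
  have [d <-] := types_realized satU q smN.
  have [i [si _ di]] := Hs d; exists (lift_params c (ch i)); first exact/tch.
  move=> q'; have [d' <-] := types_realized satU q' smN.
  move=> /tch si'; rewrite !fE !sep.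
  have [i' [_ ui' di']] := Hs d'; rewrite -(ui' _ si') in di'.
  by move: di di'; rewrite !ler_norml => /andP[? ?] /andP[? ?]; apply/andP; split; lra.
have := @Rintegral_near_simple R _ (borel_tspace iN Y) nu I
  (fun i => clopen_of (e := iN) (lift_params c (chi i))) r f delta.
have E i : fine (nu (clopen_of (e := iN) (lift_params c (chi i)))) = la (lift_params iM (chi i)).
  by rewrite nuE /= lift_params_comp.
under eq_bigr do rewrite E; apply=> // q.
have [d <-] := types_realized satU q smN.
have [i [h1 h2 h3]] := Hchi d; exists i; split; first exact/tch.
  by move=> j /tch /h2.
by rewrite fE sep.
Qed.

End MorleyProduct.

Definition snoc (Om : Type) n (f : 'I_n -> Om) (i : Om) (j : 'I_n.+1) : Om :=
  if unlift ord_max j is Some j' then f j' else i.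

(** Fubini for independent draws, with the last draw innermost, matching [split_last]. *)
Lemma sum_pweight_recr (R : realType) (Om : finType) (p : Om -> R) n
    (G : {ffun 'I_n.+1 -> Om} -> R) :
  \sum_x pweight p x * G x =
  \sum_(f : {ffun 'I_n -> Om}) pweight p f * \sum_i p i * G [ffun j => snoc f i j].
Proof.
under [RHS]eq_bigr do rewrite mulr_sumr.
rewrite pair_big /=.
rewrite (reindex (fun z : {ffun 'I_n -> Om} * Om => [ffun j => snoc z.1 z.2 j])) /=; last first.
  exists (fun x : {ffun 'I_n.+1 -> Om} => ([ffun j => x (lift ord_max j)], x ord_max)).
    move=> [f i] _ /=; congr (_, _); last by rewrite ffunE /snoc unlift_none.
    by apply/ffunP => j; rewrite !ffunE /snoc liftK.
  move=> x _; apply/ffunP => j; rewrite ffunE /snoc.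
  by case: unliftP => [j' ->|->] //=; rewrite ffunE.
apply: eq_bigr => -[f i] _ /=; rewrite mulrA; congr (_ * _).
rewrite /pweight big_ord_recr /=; congr (_ * _).
  apply: eq_bigr => j _; rewrite ffunE /snoc.
  rewrite (_ : widen_ord _ j = lift ord_max j) ?liftK //.
  by apply: val_inj; rewrite /= /bump leqNgt ltn_ord.
by rewrite ffunE /snoc unlift_none.
Qed.

(** * Morley powers as limits of averages over samples *)

Section Limit.
Variables (R : realType) (K : Type) (L : language) (U M : structure L) (iM : M -> U).
Hypotheses (satU : saturated K U) (elM : elementary iM) (smM : small K [set: M]).
Variables (k : nat) (mu : formula L ('I_k + U) -> R).
Hypotheses (hmu : keisler mu) (hdef : definable iM mu) (hfs : finitely_satisfiable iM mu).
Hypothesis NIP : forall p q (phi : formula L ('I_p + 'I_q)), exists n, NIP_dim U phi n.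

Let cmu : content id mu := hmu.

Record sample := Sample { samp_size : nat; samp : 'I_samp_size.+1 -> 'I_k -> M }.

Definition upper_approx m (phi : formula L ('I_k + 'I_m)) (eps : R) (s : sample) :=
  forall b, Av R (fun i => inM iM (samp (s := s) i)) phi b <= mu (inst phi b) + eps.

(* The filter of sets of samples containing all sufficiently good
   approximations of mu; the Morley powers of mu are limits along it. *)
Definition approx_large (P : sample -> Prop) :=
  exists m (phi : formula L ('I_k + 'I_m)) (eps : R),
    0 < eps /\ forall s, upper_approx phi eps s -> P s.

Lemma approx_large_ex P : approx_large P -> exists s, P s.
Proof.
case=> m [phi [eps [e0 H]]].
have [N [a Ha]] := finite_approximation satU smM hmu hdef hfs NIP phi e0.
by exists (Sample a); exact: H.
Qed.

Lemma approx_large_sub (P Q : sample -> Prop) :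
  (forall s, P s -> Q s) -> approx_large P -> approx_large Q.
Proof.
by move=> h [m [phi [eps [e0 H]]]]; exists m, phi, eps; split=> // s /H /h.
Qed.

Lemma approx_large_upper m (phi : formula L ('I_k + 'I_m)) (eps : R) : 0 < eps ->
  approx_large (upper_approx phi eps).
Proof. by move=> e0; exists m, phi, eps. Qed.

(** Covers the case where [combine_formulas] lacks two distinct elements: over a one-point universe
    [phi(x, b)] is everywhere true or everywhere false. *)
Lemma upper_approx_trivial : (forall x y : U, x = y) ->
  forall m (phi : formula L ('I_k + 'I_m)) (eps : R) s, 0 < eps -> upper_approx phi eps s.
Proof.
move=> triv m phi eps s e0 b.
have all_eq V (v w : V -> U) : v = w by apply/funext => z; exact: triv.
pose a0 : 'I_k -> U := fun=> point.
have [h|nh] := pselect (sat phi (join a0 b)).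
  have -> : mu (inst phi b) = 1.
    have [_ _ T _] := cmu; apply: T => a; apply/sat_inst.
    by rewrite (all_eq _ (join a b) (join a0 b)).
  by apply: le_trans (Av_le1 _ _ _ _) _; rewrite lerDl ltW.
rewrite AvE big1 ?mul0r; last first.
  by move=> i _; apply: ind_false; rewrite (all_eq _ (join _ b) (join a0 b)).
by rewrite addr_ge0 ?(content_ge0 cmu) ?ltW.
Qed.

(* Two formulas are instances of a single one, which chooses between them
   according to whether two extra parameters are equal. *)
Lemma combine_formulas (x0 y0 : U) : x0 <> y0 ->
  forall m1 m2 (phi1 : formula L ('I_k + 'I_m1)) (phi2 : formula L ('I_k + 'I_m2)),
  exists m (phi : formula L ('I_k + 'I_m)),
    (forall b1 : 'I_m1 -> U, exists b, forall a, sat phi (join a b) <-> sat phi1 (join a b1)) /\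
    (forall b2 : 'I_m2 -> U, exists b, forall a, sat phi (join a b) <-> sat phi2 (join a b2)).
Proof.
move=> xy m1 m2 phi1 phi2; pose Y : finType := (('I_m1 + 'I_m2) + bool)%type.
pose par (y : Y) : 'I_k + 'I_#|Y| := inr (enum_rank y).
pose h1 (z : 'I_k + 'I_m1) : 'I_k + 'I_#|Y| :=
  match z with inl x => inl x | inr i => par (inl (inl i)) end.
pose h2 (z : 'I_k + 'I_m2) : 'I_k + 'I_#|Y| :=
  match z with inl x => inl x | inr i => par (inl (inr i)) end.
have [phi Hphi] : expressible (fun (N : structure L) (v : 'I_k + 'I_#|Y| -> N) =>
   (v (par (inr true)) = v (par (inr false)) /\ sat phi1 (fun z => v (h1 z))) \/
   (v (par (inr true)) <> v (par (inr false)) /\ sat phi2 (fun z => v (h2 z)))).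
  apply: expressible_or; apply: expressible_and.
  - exact: expressible_eq.
  - exact: expressible_sat.
  - apply: expressible_not; exact: expressible_eq.
  - exact: expressible_sat.
exists #|Y|, phi; split=> b.
  exists (fun i => match enum_val i with inl (inl j) => b j | _ => x0 end) => a.
  rewrite Hphi /par /= !enum_rankK.
  rewrite (_ : (fun z => _ (h1 z)) = join a b); last first.
    by apply/funext => -[x|i] //=; rewrite enum_rankK.
  by split=> [[[]//|[/(_ erefl)]]//|h]; left.
exists (fun i => match enum_val i with
  inl (inr j) => b j | inr true => y0 | _ => x0 end) => a.
rewrite Hphi /par /= !enum_rankK.
rewrite (_ : (fun z => _ (h2 z)) = join a b); last first.
  by apply/funext => -[x|i] //=; rewrite enum_rankK.
split=> [[[yx _]|[_]]//|h]; last by right; split=> // yx; exact: xy.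
by case: xy.
Qed.

(** Both conditions must follow from one formula and one error: [combine_formulas] supplies the
    formula, the minimum of the errors the rest. *)
Lemma approx_large_and (P Q : sample -> Prop) :
  approx_large P -> approx_large Q -> approx_large (fun s => P s /\ Q s).
Proof.
move=> [m1 [phi1 [e1 [e10 H1]]]] [m2 [phi2 [e2 [e20 H2]]]].
have [triv|nt] := pselect (forall x y : U, x = y).
  exists m1, phi1, e1; split=> // s _.
  by split; [apply: H1|apply: H2]; exact: upper_approx_trivial.
have [x0 [y0 xy]] : exists x y : U, x <> y.
  by move/existsNP: nt => [x /existsNP[y xy]]; exists x, y.
have [m [phi [c1 c2]]] := combine_formulas xy phi1 phi2.
pose e := Num.min e1 e2.
exists m, phi, e; split; first by rewrite lt_min e10.
have [E _ _ _] := cmu.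
have key m' (phi' : formula L ('I_k + 'I_m')) e' s : e <= e' ->
   (forall b' : 'I_m' -> U, exists b, forall a, sat phi (join a b) <-> sat phi' (join a b')) ->
   upper_approx phi e s -> upper_approx phi' e' s.
  move=> ee' c us b'; have [b Hb] := c b'; have := us b.
  rewrite (E (inst phi b) (inst phi' b')); last by move=> a; rewrite !sat_inst.
  rewrite !AvE; under eq_bigr do rewrite (ind_iff R (Hb _)).
  by move/le_trans; apply; rewrite lerD2l.
move=> s us; split; [apply: H1|apply: H2]; apply: key us => //.
  by rewrite ge_min lexx.
by rewrite ge_min lexx orbT.
Qed.

Lemma approx_large_forall (I : finType) (P : I -> sample -> Prop) :
  (forall i, approx_large (P i)) -> approx_large (fun s => forall i, P i s).
Proof.
move=> H; suff : approx_large (fun s => forall i, i \in enum I -> P i s).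
  by apply: approx_large_sub => s h i; apply: h; rewrite mem_enum.
elim: (enum I) => [|i r IH].
  by exists 0%N, fFalse, 1; split.
apply: approx_large_sub (approx_large_and (H i) IH) => s [h1 h2] j.
by rewrite inE => /orP[/eqP ->|/h2].
Qed.

Lemma approx_large_two_sided m (phi : formula L ('I_k + 'I_m)) (eps : R) : 0 < eps ->
  approx_large (fun s => forall b,
    `|Av R (fun i => inM iM (samp (s := s) i)) phi b - mu (inst phi b)| <= eps).
Proof.
move=> e0; apply: approx_large_sub (approx_large_and (approx_large_upper phi e0)
  (approx_large_upper (fNot phi) e0)) => s [h1 h2] b.
have := h1 b; have := h2 b; rewrite Av_fNot.
have -> : mu (inst (fNot phi) b) = 1 - mu (inst phi b).
  by rewrite -(content_fNot cmu).
rewrite ler_norml; lra.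
Qed.

Definition unif n : 'I_n.+1 -> R := fun=> n.+1%:R^-1.

Lemma unif_ge0 n i : 0 <= @unif n i. Proof. by rewrite invr_ge0. Qed.

Lemma sum_unif n : \sum_i @unif n i = 1.
Proof. by rewrite sumr_const card_ord -[_ *+ _]mulr_natr mulVf // pnatr_eq0. Qed.

(** The measure of [psi] under the power of the uniform measure on the sample; tuples may repeat
    points. *)
Definition power_average n (s : sample) (psi : formula L ('I_n.+1 * 'I_k + M)) : R :=
  \sum_(f : {ffun 'I_n.+1 -> 'I_(samp_size s).+1}) pweight (@unif (samp_size s)) f *
    ind R (sat psi (join (fun v => iM (samp (f v.1) v.2)) iM)).

Lemma AvE_unif (s : sample) m (phi : formula L ('I_k + 'I_m)) (b : 'I_m -> U) :
  Av R (fun i => inM iM (samp (s := s) i)) phi b =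
  \sum_i @unif (samp_size s) i * ind R (sat phi (join (inM iM (samp i)) b)).
Proof. by rewrite AvE mulr_suml; apply: eq_bigr => i _; rewrite mulrC. Qed.

Definition is_power_limit n (la : formula L ('I_n.+1 * 'I_k + U) -> R) :=
  forall psi (eps : R), 0 < eps ->
    approx_large (fun s => `|la (lift_params iM psi) - power_average s psi| <= eps).

(** Every axiom holds exactly for [power_average s] and passes to the limit along the filter. *)
Lemma power_limit_content n (la : formula L ('I_n.+1 * 'I_k + U) -> R) :
  is_power_limit la -> content iM (fun psi => la (lift_params iM psi)).
Proof.
move=> lim.
have eq_small (x y : R) : (forall eps, 0 < eps -> `|x - y| <= eps) -> x = y.
  move=> h; apply/eqP; rewrite -subr_eq0 -normr_le0; apply/ler_addgt0Pr => e e0.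
  by rewrite add0r; exact: h.
split=> [psi psi' E|psi|psi T|psi psi' D].
- apply: eq_small => eps e0; have e2 : 0 < eps / 2 by rewrite divr_gt0.
  have [s [h1 h2]] := approx_large_ex (approx_large_and (lim psi _ e2) (lim psi' _ e2)).
  have e : power_average s psi = power_average s psi'.
    by apply: eq_bigr => f _; rewrite (ind_iff R (E _)).
  by move: h1 h2; rewrite e !ler_norml; lra.
- apply/ler_addgt0Pr => e e0; have [s] := approx_large_ex (lim psi _ e0).
  have : 0 <= power_average s psi.
    apply: sumr_ge0 => f _; rewrite mulr_ge0 ?ind_ge0 // pweight_ge0 //; exact: unif_ge0.
  by rewrite ler_norml; lra.
- apply: eq_small => eps e0; have [s] := approx_large_ex (lim psi _ e0).
  rewrite (_ : power_average s psi = 1) // -(sum_pweight (sum_unif (samp_size s)) n.+1).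
  by apply: eq_bigr => f _; rewrite ind_true ?mulr1.
- apply: eq_small => eps e0; have e3 : 0 < eps / 3 by rewrite divr_gt0.
  have [s [h [h1 h2]]] := approx_large_ex (approx_large_and (lim (fOr psi psi') _ e3)
     (approx_large_and (lim psi _ e3) (lim psi' _ e3))).
  have e : power_average s (fOr psi psi') = power_average s psi + power_average s psi'.
    rewrite /power_average -big_split /=; apply: eq_bigr => f _; rewrite -mulrDr; congr (_ * _).
    set v := join _ iM; have := D (fun z => iM (samp (f z.1) z.2)); rewrite -/v => nD.
    have [p|np] := pselect (sat psi v).
      rewrite (ind_true _ p) (@ind_false _ (sat psi' v)) ?addr0 ?ind_true //; first by left.
      by move=> p'; apply: nD.
    rewrite (ind_false _ np) add0r; apply: ind_iff; split; last by right.
    by case.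
  move: h h1 h2; rewrite e.
  by rewrite !ler_norml; lra.
Qed.

Lemma power_limit0 : is_power_limit (@morley_power R K L U M iM 'I_k mu 0).
Proof.
move=> psi eps e0.
pose psi0 := rename (join (fun v : 'I_1 * 'I_k => inl v.2) inr) psi : formula L ('I_k + M).
have [m [b [phi phiE]]] := parameters_finite point psi0.
have muE : morley_power K iM mu (lift_params iM psi) = mu (inst phi (iM \o b)).
  rewrite /= (_ : rename _ (lift_params iM psi) = lift_params iM psi0); last first.
    by rewrite /lift_params !rename_comp; congr rename; apply/funext => -[].
  congr mu; rewrite phiE /lift_params /inst rename_comp; congr rename.
  by apply/funext => -[].
rewrite muE; apply: approx_large_sub (approx_large_two_sided phi e0) => s /(_ (iM \o b)).
suff -> : power_average s psi =
    Av R (fun i => inM iM (samp (s := s) i)) phi (iM \o b) by rewrite distrC.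
rewrite AvE_unif -(expect_coord (sum_unif _) _ (ord0 : 'I_1)).
apply: eq_bigr => f _; congr (_ * _); apply: ind_iff.
have -> : join (inM iM (samp (f ord0))) (iM \o b) =
    join (inM iM (samp (f ord0))) iM \o join inl (inr \o b) by apply/funext => -[].
rewrite -sat_rename -[rename _ phi]/(inst phi b) -phiE sat_rename.
rewrite (_ : _ \o _ = join (fun v => iM (samp (f v.1) v.2)) iM) //.
by apply/funext => -[[i x]|c] //=; rewrite (ord1 i).
Qed.

(** Four errors of [eps / 4]: from the Morley product to a sum of levels weighted by [la], then by
    power averages (induction), then back from levels to [mu(phi(x, d))], and finally to the average
    over the last coordinate. *)
Lemma power_limitS n : is_power_limit (@morley_power R K L U M iM 'I_k mu n) ->
  is_power_limit (@morley_power R K L U M iM 'I_k mu n.+1).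
Proof.
move=> lim psi eps e0; have cla := power_limit_content lim.
set la := @morley_power R K L U M iM 'I_k mu n in lim cla *.
pose psi' := rename (join (fun v => inl (split_last v)) inr) psi :
  formula L (('I_k + 'I_n.+1 * 'I_k) + M).
have laE : morley_power K iM mu (lift_params iM psi) =
    morley_product K iM mu la (lift_params iM psi').
  rewrite /= -/la; congr morley_product; rewrite /lift_params !rename_comp.
  by congr rename; apply/funext => -[].
have [m [phi [g sep]]] := separate_variables iM psi'.
have d0 : 0 < eps / 4 by rewrite divr_gt0.
have [I [chi [r Hchi]]] := separate_partition hdef phi g d0.
have near1 := morley_product_near satU elM smM hdef cla (fun d => (sep d).1) Hchi.
(* The levels are multiplied by [r i], so their errors are divided by the total size of the [r i];
   adding 1 keeps it positive. *)
pose r1 := 1 + \sum_i `|r i|.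
have r10 : 0 < r1 by rewrite ltr_pwDl // sumr_ge0.
have dr0 : 0 < eps / 4 / r1 by rewrite divr_gt0.
apply: approx_large_sub (approx_large_and (approx_large_two_sided phi d0)
   (approx_large_forall (fun i => lim (chi i) _ dr0))) => s [h1 h2].
rewrite laE.
pose dd (f : {ffun 'I_n.+1 -> 'I_(samp_size s).+1}) (v : 'I_n.+1 * 'I_k) : U :=
  iM (samp (f v.1) v.2).
pose p := @unif (samp_size s).
have w0 f : 0 <= @pweight _ _ p n.+1 f by apply: pweight_ge0; exact: unif_ge0.
have w1 : \sum_f @pweight _ _ p n.+1 f = 1 by apply: sum_pweight; exact: sum_unif.
have avE : power_average s psi = \sum_f pweight p f *
    Av R (fun i => inM iM (samp (s := s) i)) phi (join (dd f) iM \o g).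
  rewrite /power_average [LHS]sum_pweight_recr.
  refine (eq_bigr _ _) => f _; congr (_ * _).
  rewrite AvE_unif; apply: eq_bigr => i _; congr (_ * _); apply: ind_iff.
  rewrite -(sep (dd f)).2 sat_rename (_ : _ \o _ = join (fun v => iM (samp ([ffun j => snoc f i j] v.1) v.2)) iM) //.
  apply/funext => -[[j x]|c] //=; rewrite /split_last /= ffunE /snoc.
  by case: (unlift ord_max j).
have near_avg (F G : {ffun 'I_n.+1 -> 'I_(samp_size s).+1} -> R) e :
    (forall f, `|F f - G f| <= e) ->
    `|\sum_f pweight p f * F f - \sum_f pweight p f * G f| <= e.
  move=> h; rewrite -sumrB; apply: le_trans (ler_norm_sum _ _ _) _.
  rewrite -[leRHS]mul1r -w1 mulr_suml; apply: ler_sum => f _.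
  by rewrite -mulrBr normrM ger0_norm // ler_wpM2l.
have near2 := near_avg _ _ _ (fun f => h1 (join (dd f) iM \o g)).
pose rho f := \sum_i r i * ind R (sat (chi i) (join (dd f) iM)).
have near3 : `|\sum_f pweight p f * mu (inst phi (join (dd f) iM \o g)) -
     \sum_f pweight p f * rho f| <= eps / 4.
  apply: near_avg => f; have [i [si ui hi]] := Hchi (dd f).
  rewrite /rho (bigD1 i) //= (ind_true _ si) mulr1 big1 ?addr0 // => j ji.
  by rewrite ind_false ?mulr0 // => /ui; apply/eqP.
have rhoE : \sum_f pweight p f * rho f = \sum_i r i * power_average s (chi i).
  rewrite /rho; under eq_bigr do rewrite mulr_sumr.
  rewrite exchange_big /=; apply: eq_bigr => i _; rewrite mulr_sumr.
  by apply: eq_bigr => f _; rewrite mulrCA.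
have near4 : `|\sum_i r i * la (lift_params iM (chi i)) -
    \sum_i r i * power_average s (chi i)| <= eps / 4.
  rewrite -sumrB; apply: le_trans (ler_norm_sum _ _ _) _.
  apply: (@le_trans _ _ (\sum_i `|r i| * (eps / 4 / r1))).
    by apply: ler_sum => i _; rewrite -mulrBr normrM ler_wpM2l.
  rewrite -mulr_suml mulrCA ler_piMr ?(ltW d0) // ler_pdivrMr // mul1r /r1 lerDr //.
rewrite avE; move: near1 near2 near3 near4; rewrite rhoE !ler_norml; lra.
Qed.

Theorem morley_power_limit n : is_power_limit (@morley_power R K L U M iM 'I_k mu n).
Proof. by elim: n => [|n]; [exact: power_limit0|exact: power_limitS]. Qed.

End Limit.

(** * The formula defining good tuples, and the conclusion *)

Section Fim.
Variables (R : realType) (K : Type) (L : language) (U M : structure L) (iM : M -> U).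
Hypotheses (satU : saturated K U) (elM : elementary iM) (smM : small K [set: M]).
Variables (k : nat) (mu : formula L ('I_k + U) -> R).
Hypotheses (hmu : keisler mu) (hdef : definable iM mu) (hfs : finitely_satisfiable iM mu).
Hypothesis NIP : forall p q (phi : formula L ('I_p + 'I_q)), exists n, NIP_dim U phi n.

(** Replacing [mu(phi(x, b))] by a level value makes the condition first order. The levels are
    accurate to [eps / 4], so the threshold [3 eps / 4] gives [eps] in one direction and absorbs
    [eps / 2] in the other. *)
Lemma approximation_formula n m (phi : formula L ('I_k + 'I_m)) (eps : R) : 0 < eps ->
  exists theta : formula L ('I_n.+1 * 'I_k + M), forall a : 'I_n.+1 -> 'I_k -> U,
    (sat theta (join (fun v => a v.1 v.2) iM) ->
      forall b, `|mu (inst phi b) - Av R a phi b| <= eps) /\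
    ((forall b, `|mu (inst phi b) - Av R a phi b| <= eps / 2) ->
      sat theta (join (fun v => a v.1 v.2) iM)).
Proof.
move=> e0; have e4 : 0 < eps / 4 by rewrite divr_gt0.
have [J [psi [r [cov Hr]]]] := inst_levels hdef phi e4.
pose h (z : 'I_m + M) : ('I_n.+1 * 'I_k + M) + 'I_m :=
  match z with inl y => inr y | inr c => inl (inr c) end.
pose g (i : 'I_n.+1) (z : 'I_k + 'I_m) : ('I_n.+1 * 'I_k + M) + 'I_m :=
  match z with inl x => inl (inl (i, x)) | inr y => inr y end.
pose G j (I : {set 'I_n.+1}) := `|#|I|%:R / n.+1%:R - r j| <= 3 * (eps / 4).
pose Q (N : structure L) (v : ('I_n.+1 * 'I_k + M) + 'I_m -> N) := forall j,
  ~ sat (psi j) (fun z => v (h z)) \/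
  G j [set i | `[< sat phi (fun z => v (g i z)) >]]%SET.
have HQ : expressible Q.
  apply: expressible_forall => j; apply: expressible_or.
    apply: expressible_not; exact: expressible_sat.
  apply: (@expressible_pattern L 'I_n.+1 _ (fun i N v => sat phi (fun z => v (g i z))) (G j)) => i.
  exact: expressible_sat.
have [theta Htheta] := expressible_block_forall HQ.
exists theta => a; rewrite Htheta; set A := fun v => a v.1 v.2.
have hE (b : 'I_m -> U) : (fun z => join (join A iM) b (h z)) = join b iM.
  by apply/funext => -[].
have gE (b : 'I_m -> U) i : (fun z => join (join A iM) b (g i z)) = join (a i) b.
  by apply/funext => -[].
have GE (b : 'I_m -> U) j : G j [set i | `[< sat phi (fun z => join (join A iM) b (g i z)) >]]%SET
   <-> `|Av R a phi b - r j| <= 3 * (eps / 4).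
  rewrite /G AvE (_ : #|_|%:R = \sum_i ind R (sat phi (join (a i) b))) //.
  rewrite -sum1_card natr_sum big_mkcond; apply: eq_bigr => i _.
  by rewrite inE gE /ind; case: `[< _ >].
split=> [H b|H b j].
  have [j sj] := cov b; have := Hr _ _ sj; have [] := H b j; first by rewrite hE.
  by move=> /GE; rewrite !ler_norml => /andP[? ?] /andP[? ?]; apply/andP; split; lra.
have [sj|ns] := pselect (sat (psi j) (join b iM)); last by left; rewrite hE.
right; apply/GE; have := Hr _ _ sj; have := H b; rewrite !ler_norml.
by move=> /andP[? ?] /andP[? ?]; apply/andP; split; lra.
Qed.

Theorem NIP_dfs_fim : fim K iM mu.
Proof.
split; first exact: hdef.1.
move=> m phi eps e0; have e2 : 0 < eps / 2 by rewrite divr_gt0.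
have e4 : 0 < eps / 4 by rewrite divr_gt0.
have [n Hn] := NIP_uniform_law (NIP phi) e4 e2.
have [theta Htheta] := approximation_formula n phi e0.
exists n, theta; split; last by move=> b a s; exact: (Htheta a).1.
have lim := morley_power_limit satU elM smM hmu hdef hfs NIP (n := n) theta e2.
(* One sample serves both purposes: its power average is within [eps / 2] of the Morley power on
   [theta], and it approximates [mu] on [phi] within [eps / 4]. *)
have [s [h1 h2]] := approx_large_ex satU smM hmu hdef hfs NIP
  (approx_large_and hmu lim (approx_large_two_sided iM hmu phi e4)).
pose p := @unif R (samp_size s).
have p0 i : 0 <= p i by exact: unif_ge0.
have p1 : \sum_i p i = 1 by exact: sum_unif.
have := Hn _ (fun i => inM iM (samp (s := s) i)) p p0 p1.
move=> bad; suff good : 1 - eps / 2 <= power_average R iM s theta.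
  by move: h1; rewrite ler_norml; lra.
rewrite lerBlDr -[leLHS](sum_pweight p1 n.+1).
(* A tuple outside the bad event averages [phi] within [eps / 4] of the sample, hence within
   [eps / 2] of [mu], so it satisfies [theta]. *)
apply: le_trans (lerD (lexx _) bad).
rewrite /power_average -big_split /=; apply: ler_sum => f _.
rewrite -mulrDr ler_peMr ?pweight_ge0 //.
set B := exists b, _; have [b|nb] := pselect B.
  by rewrite (ind_true _ b) lerDr ind_ge0.
rewrite [X in X + _]ind_true ?lerDl ?ind_ge0 //.
apply: (Htheta (fun i => inM iM (samp (f i)))).2 => b.
have := h2 b; rewrite AvE_unif -/p => h3.
have : ~ (eps / 4 <= `|Av R (fun i => inM iM (samp (f i))) phi b -
       \sum_a p a * ind R (sat phi (join (inM iM (samp a)) b))|) by move=> h; apply: nb; exists b.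
move/negP; rewrite -ltNge; move: h3; set S := \sum_a _.
by rewrite !ler_norml ltr_norml => /andP[? ?] /andP[? ?]; apply/andP; split; lra.
Qed.

End Fim.

Theorem theorem5p3 (R : realType) (K : Type) (L : language)
  (T : set (sentence L)) (U : structure L)
  (hT : complete_theory T) (hUT : models U T) (hU : monster K U)
  (M : structure L) (iM : M -> U) (hM : elementary iM)
  (hMsmall : small K [set: M]%classic)
  (k : nat) (mu : formula L ('I_k + U)%type -> R) (hmu : keisler mu)
  (hdef : definable iM mu) (hfs : finitely_satisfiable iM mu)
  (Ms : structure L) (j : M -> Ms) (hgood : good_extension j)
  (hNIP : forall (p q : nat) (phi : formula L ('I_p + 'I_q)%type),
     uniformly_NIP Ms phi) :
  fim K iM mu.
Proof.
apply: NIP_dfs_fim => //; first exact: hU.2.1.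
move=> p q phi; have /uniformly_NIPE[n Hn] := hNIP p q phi; exists n.
(* The bound [n] goes down from [Ms] to [M] along [j], then up to [U] along [iM]. *)
by apply/(NIP_dim_elementary _ _ hM)/(NIP_dim_elementary _ _ hgood.1).
Qed.
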